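(* Let $n\ge 3$ and let $S$ be a finite generating set of $\mathrm{SL}_n(\mathbb{Z})$ (e.g., $S=\{e_{i,j}(\pm 1): 1\le i,j\le n,\ i\neq j\}$). For every $i\in\mathbb{N}$ let $\phi_i:\mathrm{SL}_n(\mathbb{Z})\to\mathrm{SL}_n(\mathbb{Z}/i\mathbb{Z})$ be the natural surjective homomorphism. Then the family of Cayley graphs of $\{(\mathrm{SL}_n(\mathbb{Z}/i\mathbb{Z}),\phi_i(S))\}_{i\in\mathbb{N}}$ is a super-expander family.
   Context: $e_{i,j}(m)$ is the elementary matrix with $1$'s on the main diagonal, $m$ in the $(i,j)$-entry and $0$ in all other entries. A Banach space $\mathbb{E}$ is uniformly convex if there is a function $\delta:(0,2]\to(0,1]$ such that for every $0<\varepsilon\le 2$ and all unit vectors $\xi,\eta\in\mathbb{E}$ with $\|\xi-\eta\|\ge\varepsilon$ one has $\|\frac{\xi+\eta}{2}\|\le 1-\delta(\varepsilon)$. A Banach space is super-reflexive if and only if it admits an equivalent uniformly convex norm (this can be taken as the definition). Let $\mathbb{E}$ be a Banach space and let $\{(V_i,E_i)\}_{i\in\mathbb{N}}$ be a sequence of finite graphs with uniformly bounded degree such that $\lim_i|V_i|=\infty$. The sequence has a Poincaré inequality with respect to $\mathbb{E}$ if there are constants $p,\gamma\in(0,\infty)$ such that for every $i\in\mathbb{N}$ and every $\phi:V_i\to\mathbb{E}$, $$\frac{1}{|V_i|^2}\sum_{(u,v)\in V_i\times V_i}\|\phi(u)-\phi(v)\|^p\le\frac{\gamma}{|V_i|}\sum_{(x,y)\in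 E_i}\|\phi(x)-\phi(y)\|^p.$$ The sequence is a super-expander family if it has a Poincaré inequality with respect to every super-reflexive Banach space (equivalently, every uniformly convex Banach space). *)

(* Defs.v *)
From HB Require Import structures.
From mathcomp Require Import all_boot all_order all_fingroup all_algebra.
From mathcomp Require Import all_classical all_reals all_analysis.

Set Implicit Arguments.
Unset Strict Implicit.
Unset Printing Implicit Defensive.

Import Order.TTheory GRing.Theory Num.Theory.
Import numFieldNormedType.Exports.

Local Open Scope classical_set_scope.
Local Open Scope ring_scope.

(* The ring Z/mZ for every m >= 1, including the zero ring Z/1Z; ['Z_m] is not
   used because ['Z_1] is Z/2Z. The value at m = 0 is junk (it is Z/1Z). *)
Definition Zmod (m : nat) : Type := 'I_m.-1.+1.

HB.instance Definition _ (m : nat) := Finite.on (Zmod m).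
HB.instance Definition _ (m : nat) := GRing.Zmodule.on (Zmod m).
HB.instance Definition _ (m : nat) :=
  GRing.Zmodule_isComPzRing.Build (Zmod m) (@Zp_mulA _) (@Zp_mulC _)
    (@Zp_mul1z _) (@Zp_mul_addl _).

Record SL (n : nat) (A : comPzRingType) : Type :=
  MkSL { SLval :> 'M[A]_n; SL_det : \det SLval == 1 }.

HB.instance Definition _ (n : nat) (A : comPzRingType) :=
  [isSub for @SLval n A].
HB.instance Definition _ (n : nat) (A : comPzRingType) :=
  [Choice of SL n A by <:].
HB.instance Definition _ (n m : nat) := [Finite of SL n (Zmod m) by <:].

Section SLGroup.
Variables (n : nat) (A : comPzRingType).
Implicit Types x y z : SL n A.

Fact SL_one_subproof : \det (1%:M : 'M[A]_n) == 1.
Proof. by rewrite det1. Qed.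

Fact SL_mul_subproof x y : \det (SLval x *m SLval y) == 1.
Proof. by rewrite det_mulmx (eqP (SL_det x)) (eqP (SL_det y)) mulr1. Qed.

Fact SL_inv_subproof x : \det (\adj (SLval x)) == 1.
Proof.
have := congr1 determinant (mul_mx_adj (SLval x)).
by rewrite det_mulmx (eqP (SL_det x)) mul1r det1 => ->.
Qed.

Definition SL_one : SL n A := MkSL SL_one_subproof.
Definition SL_mul x y : SL n A := MkSL (SL_mul_subproof x y).
Definition SL_inv x : SL n A := MkSL (SL_inv_subproof x).

Fact SL_mulA : associative SL_mul.
Proof. by move=> x y z; apply: val_inj; rewrite /= mulmxA. Qed.

Fact SL_mul1 : left_id SL_one SL_mul.
Proof. by move=> x; apply: val_inj; rewrite /= mul1mx. Qed.

Fact SL_mulr1 : right_id SL_one SL_mul.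
Proof. by move=> x; apply: val_inj; rewrite /= mulmx1. Qed.

Fact SL_mulV : left_inverse SL_one SL_inv SL_mul.
Proof.
by move=> x; apply: val_inj; rewrite /= mul_adj_mx (eqP (SL_det x)).
Qed.

Fact SL_mulrV : right_inverse SL_one SL_inv SL_mul.
Proof.
by move=> x; apply: val_inj; rewrite /= mul_mx_adj (eqP (SL_det x)).
Qed.

HB.instance Definition _ := isGroup.Build (SL n A)
  SL_mulA SL_mul1 SL_mulr1 SL_mulV SL_mulrV.

End SLGroup.

HB.instance Definition _ (n m : nat) := Group.on (SL n (Zmod m)).

(* The homomorphism SL_n(Z) -> SL_n(Z/mZ) (for m >= 1). *)
Section Reduction.
Variables (n m : nat).

Fact SL_red_subproof (x : SL n int) :
  \det (map_mx (fun z : int => z%:~R : Zmod m) (SLval x)) == 1.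
Proof.
by rewrite (det_map_mx (intmul (1 : Zmod m))) (eqP (SL_det x)) rmorph1.
Qed.

Definition SL_red (x : SL n int) : SL n (Zmod m) := MkSL (SL_red_subproof x).

Fact SL_redM : {morph SL_red : x y / (x * y)%g}.
Proof.
by move=> x y; apply: val_inj; rewrite /= (map_mxM (intmul (1 : Zmod m))).
Qed.

Fact SL_red1 : SL_red 1%g = 1%g.
Proof. by apply: val_inj; rewrite /= (map_mx1 (intmul (1 : Zmod m))). Qed.

HB.instance Definition _ :=
  isUMagmaMorphism.Build (SL n int) (SL n (Zmod m)) SL_red (conj SL_red1 SL_redM).

End Reduction.

Definition generates (G : groupType) (S : seq G) : Prop :=
  forall x : G, exists2 w : seq G,
    all (fun g : G => (g \in S) || (g^-1%g \in S)) w & x = (\prod_(g <- w) g)%g.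

(* Finite undirected graphs without multiple edges. Loops are allowed; they
   contribute nothing to a Poincare inequality. *)
Record fgraph : Type := FGraph {
  vertex :> finType;
  edge : rel vertex;
  edge_sym : symmetric edge }.

(* S need not be symmetric: x and y are adjacent when y = x s or x = y s for
   some s in S. *)
Section Cayley.
Variables (G : finGroupType) (S : seq G).

Definition cayley_rel : rel G :=
  fun x y => ((x^-1 * y)%g \in S) || ((y^-1 * x)%g \in S).

Fact cayley_rel_sym : symmetric cayley_rel.
Proof. by move=> x y; rewrite /cayley_rel orbC. Qed.

Definition cayley_graph : fgraph := FGraph cayley_rel_sym.

End Cayley.

Section BanachSpaces.
Variables (R : realType) (E : completeNormedModType R).
Implicit Type N : E -> R.

Definition is_norm N : Prop :=
  [/\ forall x y, N (x + y) <= N x + N y,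
      forall (a : R) x, N (a *: x) = `|a| * N x
    & forall x, N x = 0 -> x = 0].

Definition equivalent_to_norm N : Prop :=
  exists c C : R, [/\ 0 < c, 0 < C & forall x, c * `|x| <= N x <= C * `|x|].

Definition uniformly_convex N : Prop :=
  exists delta : R -> R, forall eps : R, 0 < eps <= 2 ->
    0 < delta eps <= 1 /\
    (forall x y : E, N x = 1 -> N y = 1 -> eps <= N (x - y) ->
       N (2^-1 *: (x + y)) <= 1 - delta eps).

Definition super_reflexive : Prop :=
  exists N : E -> R, [/\ is_norm N, equivalent_to_norm N & uniformly_convex N].

(* The edge sum runs over ordered pairs, so every non-loop edge is counted
   twice; this only changes gamma by a factor 2. *)
Definition poincare (X : nat -> fgraph) : Prop :=
  exists p gamma : R, [/\ 0 < p, 0 < gamma &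
    forall (i : nat) (phi : X i -> E),
      (#|X i|%:R ^+ 2)^-1 *
        (\sum_(uv : X i * X i) `|phi uv.1 - phi uv.2| `^ p)
      <= gamma / #|X i|%:R *
        (\sum_(xy : X i * X i | edge xy.1 xy.2) `|phi xy.1 - phi xy.2| `^ p)].

End BanachSpaces.

Definition bounded_degree (X : nat -> fgraph) : Prop :=
  exists d : nat, forall (i : nat) (x : X i), (#|[pred y | edge x y]| <= d)%N.

Definition super_expander_family (R : realType) (X : nat -> fgraph) : Prop :=
  [/\ bounded_degree X,
      #|X i| @[i --> \oo] --> \oo
    & forall E : completeNormedModType R, super_reflexive E -> poincare E X].

(* Main.v *)
Require Import Defs.
From HB Require Import structures.
From mathcomp Require Import all_boot all_order all_fingroup all_algebra.
From mathcomp Require Import all_classical all_reals all_analysis.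
From mathcomp Require Import ring lra zify.

(** An equivalent norm changes a Poincare inequality only by a constant, so the
Banach space [E] may be taken uniformly convex.  Let [G] be [SL_n(Z/m)].
Functions from [G] to [E], with their l2 norm [N], form a uniformly convex space whose modulus does
not depend on [G] ([l2_midpoint_gap]), and [G] acts on it isometrically by
right translation.  With exponent 2 the Poincare inequality says that if each
generator moves a function [f] by at most [D] in norm, then each element of [G]
moves [f] by [O(D)], uniformly in [m] ([uniform_displacement]).

The core is a form of relative property (T) valid for all isometric actions on
such spaces ([relative_invariance]): let [i], [j], [k] be distinct indices; if
the six elementary matrices with entry 1 at a position formed from these indices
move [v] by at most [d], then every power of the first of them moves [v] by at
most [K * d + eps * N v], where [K] depends on [eps] and on the modulus of
convexity only.  For a root element [x] write [X^d] for the average of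
[1, x, ..., x^(2^d - 1)], an operator of norm at most 1; call [d] its level.

- Heisenberg estimate ([annulus_decay]).  Let [x] and [y] have the central
  commutator [z].  The operator [Z^i (1 - z^(2^i))] selects the part of the
  spectrum of [z] at distance about [2^-i] from 1.  If [(1 + x^a) / 2] and
  [(1 + y^b) / 2] with [a b = 2^i] both almost preserve the norm of [u], then by
  uniform convexity [x^a] and [y^b] almost fix [u], hence so does their
  commutator [z^(2^i)], which is impossible on that part of the spectrum.  The
  product [X^d Y^d] contains many such pairs, and the factors of a sparse family
  of pairs can be brought together, because their commutators are powers [z^c]
  with [c] much smaller than [2^i].  So [X^d Y^d Z^i (1 - z^(2^i))] is small when
  [i] is far from 0 and from [2 d], and by telescoping over [i] the operator
  [X^d Z^i Y^d] hardly depends on [i] in that range ([raise]).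

- The hexagon ([double_scale]).  In the cyclic order of the six roots of [A_2]
  each root is the sum of its two neighbours.  Hence in a word of averages any
  letter standing between its two neighbours may change its level.  The letters
  at the ends of the word seem stuck, but three consecutive letters whose middle
  level exceeds the sum of the outer levels almost commute and can be reversed
  ([flip]).  Reversing both halves of [0 1 2 3 4 5] moves the end letters to the
  interior, so all levels can be doubled.  The errors for successive doublings
  are summable, so the word at a fixed scale is close to the words at all larger
  scales, which start with an arbitrarily long average over the first root
  group.  A vector almost fixed by the six generators is almost fixed by the
  word at a fixed scale, hence almost fixed by the whole root group.

- From root groups to [G].  Since [Z/m] has stable range 1, each element of [G]
  is a product of boundedly many elementary matrices ([bounded_generation]).  A
  function of mean zero is no longer than its largest displacement
  ([mean_zero_le]); this absorbs the error term [eps * N v]. *)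

Set Implicit Arguments.
Unset Strict Implicit.
Unset Printing Implicit Defensive.
Import Order.TTheory GRing.Theory Num.Theory.

(** * Averages along isometric one-parameter semigroups *)

Section Contractions.
Local Open Scope ring_scope.

Record seminorm (R : rcfType) (V : lmodType R) := Seminorm {
  snorm :> V -> R;
  snormD : forall u v, snorm (u + v) <= snorm u + snorm v;
  snormZ : forall (a : R) u, snorm (a *: u) = `|a| * snorm u }.

Variables (R : rcfType) (V : lmodType R) (N : seminorm V).

Lemma snorm0 : N 0 = 0.
Proof. by rewrite -(scale0r 0) snormZ normr0 mul0r. Qed.

Lemma snormN u : N (- u) = N u.
Proof. by rewrite -scaleN1r snormZ normrN1 mul1r. Qed.

Lemma snorm_distC u v : N (u - v) = N (v - u).
Proof. by rewrite -snormN opprB. Qed.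

Lemma snorm_ge0 u : 0 <= N u.
Proof. by have := snormD N u (- u); rewrite snormN subrr snorm0; lra. Qed.

Lemma snorm_dist_triangle v u w : N (u - w) <= N (u - v) + N (v - w).
Proof. by rewrite -{1}(subrK v u) -addrA snormD. Qed.

Lemma snorm_half u : N (2^-1 *: u) = 2^-1 * N u.
Proof. by rewrite snormZ ger0_norm // invr_ge0 ler0n. Qed.

(** All operators below are compositions and averages of isometries; recording
linearity and the norm bound in the type lets an estimate be transported through
a composition without further hypotheses. *)
Record contraction := Contraction {
  contraction_fun :> V -> V;
  contraction_linear : forall a u v, contraction_fun (a *: u + v) = a *: contraction_fun u + contraction_fun v;
  contraction_le : forall v, N (contraction_fun v) <= N v }.
Implicit Types S T C : contraction.

Lemma contrD T u v : T (u + v) = T u + T v.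
Proof. by rewrite -[u in LHS]scale1r contraction_linear scale1r. Qed.

Lemma contr0 T : T 0 = 0.
Proof. by apply: (addrI (T 0)); rewrite -contrD !addr0. Qed.

Lemma contrZ T a u : T (a *: u) = a *: T u.
Proof. by rewrite -[a *: u]addr0 contraction_linear contr0 addr0. Qed.

Lemma contrN T u : T (- u) = - T u.
Proof. by rewrite -scaleN1r contrZ scaleN1r. Qed.

Lemma contrB T u v : T (u - v) = T u - T v.
Proof. by rewrite contrD contrN. Qed.

Fact id_contr_linear a (u v : V) : id (a *: u + v) = a *: id u + id v.
Proof. by []. Qed.
Definition id_contr := Contraction id_contr_linear (fun v => lexx _).

Fact comp_contr_linear S T a u v : S (T (a *: u + v)) = a *: S (T u) + S (T v).
Proof. by rewrite !contraction_linear. Qed.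
Fact comp_contr_le S T v : N (S (T v)) <= N v.
Proof. exact: le_trans (contraction_le _ _) (contraction_le _ _). Qed.
Definition comp_contr S T := Contraction (comp_contr_linear S T) (comp_contr_le S T).

Fact mid_contr_linear S T a u v : 2^-1 *: (S (a *: u + v) + T (a *: u + v)) =
  a *: (2^-1 *: (S u + T u)) + 2^-1 *: (S v + T v).
Proof.
rewrite !contraction_linear addrACA -scalerDr [LHS]scalerDr !scalerA.
by rewrite [a * _]mulrC.
Qed.
Fact mid_contr_le S T v : N (2^-1 *: (S v + T v)) <= N v.
Proof.
rewrite snorm_half; have := snormD N (S v) (T v); have := contraction_le S v; have := contraction_le T v.
lra.
Qed.
Definition mid_contr S T := Contraction (mid_contr_linear S T) (mid_contr_le S T).

Fact opp_contr_linear T a u v : - T (a *: u + v) = a *: (- T u) + - T v.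
Proof. by rewrite contraction_linear opprD scalerN. Qed.
Fact opp_contr_le T v : N (- T v) <= N v.
Proof. by rewrite snormN contraction_le. Qed.
Definition opp_contr T := Contraction (opp_contr_linear T) (opp_contr_le T).

Definition commuting S T := forall v, S (T v) = T (S v).

Lemma commuting_sym S T : commuting S T -> commuting T S. Proof. by move=> h v; rewrite h. Qed.
Lemma commuting_comp S T T' : commuting S T -> commuting S T' -> commuting S (comp_contr T T').
Proof. by move=> h h' v /=; rewrite h h'. Qed.
Lemma commuting_mid S T T' : commuting S T -> commuting S T' -> commuting S (mid_contr T T').
Proof. by move=> h h' v /=; rewrite contrZ contrD h h'. Qed.
Lemma commuting_opp S T : commuting S T -> commuting S (opp_contr T).
Proof. by move=> h v /=; rewrite contrN h. Qed.

(** The powers of one linear isometry; nonnegative powers suffice because the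
translations act through a finite group. *)
Record flow := Flow {
  flow_fun :> nat -> contraction;
  flow0 : forall v, flow_fun 0 v = v;
  flowD : forall a b v, flow_fun (a + b)%N v = flow_fun a (flow_fun b v);
  flow_isometry : forall a v, N (flow_fun a v) = N v }.
Implicit Types U X Y Z : flow.

Definition commute_flows X Y := forall a b, commuting (X a) (Y b).

Lemma commute_flows_refl X : commute_flows X X.
Proof. by move=> a b v; rewrite -!flowD addnC. Qed.

Definition half_step U s : contraction := mid_contr id_contr (U (2 ^ s)%N).

(** The average over [0, 2^d) is the product of the commuting operators [(1 +
U^(2^s)) / 2] for [s < d]; single factors can be removed and rearranged, which
is why averages are encoded by lists of exponents. *)
Fixpoint average U (I : seq nat) : contraction :=
  if I is s :: I' then comp_contr (half_step U s) (average U I') else id_contr.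

Definition box U d := average U (iota 0 d).

Lemma commuting_average S U I : (forall a, commuting S (U a)) -> commuting S (average U I).
Proof.
move=> h; elim: I => [|s I IH] //=; apply: commuting_comp => //.
exact: commuting_mid.
Qed.

Lemma average_commute X Y I J : commute_flows X Y -> commuting (average X I) (average Y J).
Proof.
move=> h; apply: commuting_average => b; apply: commuting_sym; apply: commuting_average => a.
exact: commuting_sym.
Qed.

Lemma average_cat U I J v : average U (I ++ J) v = average U I (average U J v).
Proof. by elim: I v => //= s I IH v; rewrite IH. Qed.

Lemma average_perm U I J v : perm_eq I J -> average U I v = average U J v.
Proof.
have cc I1 I2 w : average U I1 (average U I2 w) = average U I2 (average U I1 w).
  exact/average_commute/commute_flows_refl.
elim: I J v => [|s I IH] J v hp.
  by have /perm_nilP -> : perm_eq J [::] by rewrite perm_sym.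
have sJ : s \in J by rewrite -(perm_mem hp) mem_head.
case/splitPr: sJ hp => J1 J2 hp.
have hI : perm_eq I (J1 ++ J2).
  by rewrite -(perm_cons s) (perm_trans hp) // perm_catC /= perm_cons perm_catC.
rewrite average_cat /= (IH _ v hI) average_cat.
exact: (cc [:: s] J1).
Qed.

Lemma boxS U d v : box U d.+1 v = box U d (half_step U d v).
Proof. by rewrite /box -addn1 iotaD average_cat. Qed.

Lemma box_sub U d I v : uniq I -> {in I, forall s, (s < d)%N} ->
  box U d v = average U I (average U [seq s <- iota 0 d | s \notin I] v).
Proof.
move=> uI hI; rewrite -average_cat; apply: average_perm.
rewrite perm_sym; apply: uniq_perm.
- rewrite cat_uniq uI filter_uniq ?iota_uniq // andbT /=.
  by apply/hasPn => s; rewrite mem_filter => /andP[].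
- exact: iota_uniq.
move=> s; rewrite mem_cat mem_filter mem_iota /= add0n.
by case sI: (s \in I) => //=; rewrite hI.
Qed.

Lemma flow_displacement U a v : N (U a v - v) <= a%:R * N (U 1%N v - v).
Proof.
elim: a => [|a IH]; first by rewrite flow0 subrr snorm0 mul0r.
rewrite -addn1 flowD natrD mulrDl mul1r.
apply: le_trans (snorm_dist_triangle (U a v) _ _) _.
by rewrite -contrB flow_isometry addrC lerD2r.
Qed.

Lemma flow_box U d v : U 1%N (box U d v) - box U d v =
  2^-1 ^+ d *: (U (2 ^ d)%N v - v).
Proof.
elim: d v => [|d IH] v; first by rewrite expr0 scale1r.
rewrite boxS IH exprSr -scalerA; congr (_ *: _) => /=.
rewrite contrZ contrD -flowD addnn -mul2n -expnS -scalerBr; congr (_ *: _).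
by rewrite [v + _]addrC [U _ v + _]addrC addrKA.
Qed.

(** Telescoping: [(U - 1)] times the average over [0, 2^d) is [2^-d (U^(2^d) -
1)]. *)
Lemma flow_box_le U d a v :
  N (U a (box U d v) - box U d v) <= a%:R * 2 * 2^-1 ^+ d * N v.
Proof.
apply: le_trans (flow_displacement _ _ _) _.
rewrite flow_box snormZ ger0_norm ?exprn_ge0 ?invr_ge0 ?ler0n // -!mulrA.
apply: ler_wpM2l => //; rewrite mulrCA.
apply: ler_wpM2l; rewrite ?exprn_ge0 ?invr_ge0 ?ler0n //.
by have := snormD N (U (2 ^ d)%N v) (- v); rewrite snormN flow_isometry; lra.
Qed.

Lemma box_displacement U d v : N (box U d v - v) <= 2 ^+ d * N (U 1%N v - v).
Proof.
elim: d v => [|d IH] v; first by rewrite subrr snorm0 mulr_ge0 ?snorm_ge0 ?exprn_ge0.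
rewrite boxS; apply: le_trans (snorm_dist_triangle (half_step U d v) _ _) _.
have hv : half_step U d v - v = 2^-1 *: (U (2 ^ d)%N v - v).
  have e : v = 2^-1 *: v + 2^-1 *: v.
    by rewrite -scalerDl -[2^-1]mul1r -splitr scale1r.
  by rewrite /= scalerDr scalerBr {3}e [_ + 2^-1 *: U _ v]addrC addrKA.
have h1 : N (half_step U d v - v) <= 2 ^+ d * N (U 1%N v - v) / 2.
  rewrite hv snorm_half; have := flow_displacement U (2 ^ d)%N v; rewrite natrX.
  lra.
have h2 : N (U 1%N (half_step U d v) - half_step U d v) <= N (U 1%N v - v).
  rewrite /= contrZ contrD -flowD addnC flowD -scalerBr opprD addrACA -contrB snorm_half.
  have := snormD N (U 1%N v - v) (U (2 ^ d)%N (U 1%N v - v)); rewrite flow_isometry.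
  lra.
have := IH (half_step U d v); have : (0:R) < 2 ^+ d by rewrite exprn_gt0.
rewrite exprS; move: (snorm_ge0 (U 1%N v - v)); nra.
Qed.

End Contractions.

(** * The Heisenberg estimate *)

Section Heisenberg.
Local Open Scope ring_scope.
Variables (R : rcfType) (V : lmodType R) (N : seminorm V).
Implicit Types (X Y Z : flow N) (u v w : V).

(** The last clause says that the commutator of [X^a] and [Y^b] is [Z^(ab)] or
its inverse.  Stating it with norms makes the definition symmetric in [X] and
[Y] and independent of the sign of the commutator, so the signs of the structure
constants of the root system never appear. *)
Definition heisenberg X Y Z : Prop :=
  [/\ commute_flows X Z, commute_flows Y Z &
    forall a b v, N (X a (Y b v) - Y b (X a v)) = N (Z (a * b)%N v - v)].

Lemma heisenberg_sym X Y Z : heisenberg X Y Z -> heisenberg Y X Z.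
Proof. by case=> h1 h2 h3; split=> // a b v; rewrite snorm_distC h3 mulnC. Qed.

Definition binary_weight (I : seq nat) : nat := (\sum_(s <- I) 2 ^ s)%N.

Lemma binary_weight_iota s h : (binary_weight (iota s h) + 2 ^ s = 2 ^ (s + h))%N.
Proof.
elim: h s => [|h IH] s; first by rewrite /binary_weight big_nil addn0.
by rewrite /binary_weight /= big_cons -addnA addnC -addnA addnn -mul2n -expnS IH addSnnS.
Qed.

Lemma average_flow_commutator X Y Z I b tau u : heisenberg X Y Z ->
  N (Z 1%N u - u) <= tau ->
  N (average X I (Y b u) - Y b (average X I u)) <= (binary_weight I * b)%:R * tau.
Proof.
move=> [hXZ hYZ h] hu; have t0 : 0 <= tau by exact: le_trans (snorm_ge0 _ _) hu.
elim: I => [|s I IH]; first by rewrite /= subrr snorm0 mulr_ge0.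
rewrite /binary_weight big_cons mulnDl natrD mulrDl [leRHS]addrC.
set A := average X I in IH *.
have -> : average X (s :: I) (Y b u) - Y b (average X (s :: I) u) =
  half_step X s (A (Y b u) - Y b (A u)) +
  2^-1 *: (X (2 ^ s)%N (Y b (A u)) - Y b (X (2 ^ s)%N (A u))).
  rewrite /= -/A contrZ contrD -scalerBr -scalerDr; congr (_ *: _).
  by rewrite contrB -[RHS]addrA [_ - X _ _ + _]addrA subrK opprD addrACA.
apply: le_trans (snormD N _ _) _; apply: lerD.
  exact: le_trans (contraction_le _ _) IH.
rewrite snorm_half h.
have := flow_displacement Z (2 ^ s * b)%N (A u).
have : N (Z 1%N (A u) - A u) <= tau.
  have c : commuting (Z 1%N) A by apply: commuting_average => a; exact/commuting_sym/hXZ.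
  by rewrite c -contrB; apply: le_trans (contraction_le _ _) hu.
have : 0 <= (2 ^ s * b)%:R :> R by [].
move: (_ %:R) => x; move: (snorm_ge0 N (Z (2 ^ s * b)%N (A u) - A u)); nra.
Qed.

(** [binary_weight I] bounds the exponents of [X] that occur, so the commutators
are powers [Z^c] with [c] at most the product of the two weights. *)
Lemma average_commutator X Y Z I J tau u : heisenberg X Y Z ->
  N (Z 1%N u - u) <= tau ->
  N (average X I (average Y J u) - average Y J (average X I u)) <=
    (binary_weight I * binary_weight J)%:R * tau.
Proof.
move=> hh hu; have [hXZ hYZ h] := hh.
have t0 : 0 <= tau by exact: le_trans (snorm_ge0 _ _) hu.
elim: J => [|t J IH]; first by rewrite /= subrr snorm0 mulr_ge0.
rewrite {2}/binary_weight big_cons mulnDr natrD mulrDl.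
set w := average Y J u.
apply: le_trans (snorm_dist_triangle N (half_step Y t (average X I w)) _ _) _.
apply: lerD; last by rewrite /= -scalerBr opprD addrACA -contrB -[_ + _]/(id_contr N _ + _);
  apply: le_trans (contraction_le (half_step Y t) _) IH.
rewrite /= contrZ contrD -scalerBr opprD addrACA subrr add0r snorm_half.
have hw : N (Z 1%N w - w) <= tau.
  have c : commuting (Z 1%N) (average Y J) by apply: commuting_average => a; exact/commuting_sym/hYZ.
  by rewrite c -contrB; apply: le_trans (contraction_le _ _) hu.
have := average_flow_commutator I (2 ^ t)%N hh hw.
have : 0 <= (binary_weight I * 2 ^ t)%:R * tau by rewrite mulr_ge0.
by move: (snorm_ge0 N (average X I (Y (2 ^ t)%N w) - Y (2 ^ t)%N (average X I w))); lra.
Qed.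

(** This operator, applied after [box Z i], localizes [Z] in the annulus of
elements at distance about [2^-i] from 1. *)
Definition half_diff Z i : contraction N := mid_contr (id_contr N) (opp_contr (Z (2 ^ i)%N)).

(** With [P_i = (1 - Z^(2^i)) / 2] this is [P_i = P_{i+1} / 2 + P_i^2], that is
[P_{i+1} = 2 P_i (1 - P_i)].  Where [P_i] is small, passing to the next level
therefore gains a factor of almost 2. *)
Lemma half_diff_level Z i u :
  half_diff Z i u = 2^-1 *: half_diff Z i.+1 u + half_diff Z i (half_diff Z i u).
Proof.
rewrite /= contrZ contrB -flowD addnn -mul2n -expnS -scalerN -!scalerDr; congr (_ *: _).
set a := Z (2 ^ i)%N u; set b := Z _ u.
rewrite opprB.
have -> : u - b + (u - a + (b - a)) = 2 *: (u - a).
  by rewrite scaler_nat mulr2n addrCA [u - b + _]addrA subrK.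
by rewrite scalerA mulVf ?pnatr_eq0 // scale1r.
Qed.


(** Uniform convexity at the single scale [eps], in a homogeneous form that
needs no normalization; one value of [eps] is all that the argument consumes. *)
Definition midpoint_gap (N : seminorm V) (eps eta : R) : Prop :=
  forall u v, N v = N u -> eps * N u <= N (u - v) ->
    N (2^-1 *: (u + v)) <= (1 - eta) * N u.

Lemma half_step_dichotomy eps eta X s u : midpoint_gap N eps eta ->
  (1 - eta) * N u < N (half_step X s u) -> N (u - X (2 ^ s)%N u) <= eps * N u.
Proof.
move=> gap lt_u; rewrite leNgt; apply/negP => /ltW hu.
by have := gap _ _ (flow_isometry _ _ _) hu; rewrite leNgt lt_u.
Qed.

Lemma average_le_half_step X I s u : s \in I -> N (average X I u) <= N (half_step X s u).
Proof.
move=> sI; rewrite (average_perm _ _ (perm_to_rem sI)) /=.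
rewrite -[X in N X]/(average X [:: s] (average X (rem s I) u)).
rewrite (average_commute [:: s] _ (commute_flows_refl X)).
exact: contraction_le.
Qed.

(** If the product of averages loses little norm on [u], then neither [Y^(2^t)]
nor [X^(2^s)] moves [u] much, hence neither does their commutator [Z^(2^(s+t))].
One stage with a whole run of exponents [s] treats all the levels [s + t] at
once. *)
Lemma stage_dichotomy eps eta X Y Z I s t u : midpoint_gap N eps eta ->
  0 <= eps -> eta <= 1 -> heisenberg X Y Z -> s \in I ->
  (1 - eta) * N u < N (average X I (half_step Y t u)) ->
  N (half_diff Z (s + t) u) <= 4 * eps * N u.
Proof.
move=> gap eps0 eta1 [_ _ h] sI lt_u.
set w := half_step Y t u in lt_u.
have wu : N w <= N u := contraction_le _ _.
have ltw : (1 - eta) * N u < N w := lt_le_trans lt_u (contraction_le _ _).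
have hy := half_step_dichotomy gap ltw.
have hwu : N (u - w) <= eps * N u.
  have -> : u - w = 2^-1 *: (u - Y (2 ^ t)%N u).
    have e : u = 2^-1 *: u + 2^-1 *: u.
      by rewrite -scalerDl -[2^-1]mul1r -splitr scale1r.
    by rewrite /w /= scalerDr {1}e addrKA scalerBr.
  by rewrite snorm_half; move: (snorm_ge0 N (u - Y (2 ^ t)%N u)); lra.
have hx : N (w - X (2 ^ s)%N w) <= eps * N w.
  apply: (half_step_dichotomy gap); apply: le_lt_trans (_ : _ <= (1 - eta) * N u) _.
    by apply: ler_wpM2l wu; rewrite subr_ge0.
  exact: lt_le_trans lt_u (average_le_half_step _ _ sI).
have hxu : N (u - X (2 ^ s)%N u) <= 3 * eps * N u.
  apply: le_trans (snorm_dist_triangle _ w _ _) _.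
  have h1 := snorm_dist_triangle N (X (2 ^ s)%N w) w (X (2 ^ s)%N u).
  rewrite -contrB flow_isometry [N (w - u)]snorm_distC in h1.
  have : eps * N w <= eps * N u.
    exact: ler_wpM2l wu.
  lra.
have hz : N (Z (2 ^ (s + t))%N u - u) <= 8 * eps * N u.
  rewrite expnD -h; set x := X _; set y := Y _.
  apply: le_trans (snorm_dist_triangle _ (x u) _ _) _.
  apply: le_trans (lerD (lexx _) (snorm_dist_triangle _ u _ _)) _.
  apply: le_trans (lerD (lexx _) (lerD (lexx _) (snorm_dist_triangle _ (y u) _ _))) _.
  rewrite -!contrB !flow_isometry [N (y u - u)]snorm_distC [N (x u - u)]snorm_distC -/x -/y.
  by move: hy hxu; rewrite -/x -/y; lra.
by rewrite /= snorm_half -[u - _]opprB snormN; lra.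
Qed.


Section Windows.
Variables (m h s0 : nat).
(** The k-th stage uses [X] with exponents in the run of length [h] starting at
[xpos k], and [Y] with the exponent [ypos k]; both positions sum to [m].  The
step [2 h] leaves a gap of length [h] after each run, which makes the
commutators of different stages smaller than [2^m] by a factor [2^h]. *)
Definition xpos k := (s0 + k * (h + h))%N.
Definition ypos k := (m - xpos k)%N.

Fixpoint xruns k : seq nat := if k is k'.+1 then iota (xpos k') h ++ xruns k' else [::].
Fixpoint yposs k : seq nat := if k is k'.+1 then ypos k' :: yposs k' else [::].

Lemma binary_weight_xruns k : (binary_weight (xruns k) * 2 ^ h <= 2 ^ xpos k)%N.
Proof.
elim: k => [|k IH]; first by rewrite /binary_weight big_nil mul0n.
rewrite /binary_weight /= big_cat /= -/(binary_weight _) -/(binary_weight _).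
have := binary_weight_iota (xpos k) h.
have -> : xpos k.+1 = (xpos k + h + h)%N by rewrite /xpos; lia.
rewrite [(2 ^ (_ + h + h))%N]expnD leq_pmul2r ?expn_gt0 // => <-.
rewrite leq_add2l; apply: leq_trans IH.
by rewrite leq_pmulr ?expn_gt0.
Qed.

Lemma xruns_lt k s : s \in xruns k -> (s < xpos k)%N.
Proof.
elim: k => [|k IH] //=; rewrite mem_cat mem_iota => /orP[|/IH]; rewrite /xpos; lia.
Qed.

Lemma xruns_uniq k : uniq (xruns k).
Proof.
elim: k => [|k IH] //=; rewrite cat_uniq iota_uniq IH /= andbT.
apply/hasPn => s /xruns_lt hs; rewrite mem_iota; lia.
Qed.

Lemma yposs_gt k t : (0 < h)%N -> (xpos k <= m)%N -> t \in yposs k ->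
  (ypos k < t <= m - s0)%N.
Proof.
move=> h0; elim: k => [|k IH] //= hk.
have hk' : (xpos k <= m)%N by apply: leq_trans hk; rewrite /xpos; lia.
rewrite inE => /orP[/eqP->|/(IH hk')]; move: hk; rewrite /ypos /xpos; lia.
Qed.

Lemma yposs_uniq k : (0 < h)%N -> (xpos k <= m)%N -> uniq (yposs k).
Proof.
move=> h0; elim: k => [|k IH] //= hk.
have hk' : (xpos k <= m)%N by apply: leq_trans hk; rewrite /xpos; lia.
rewrite IH // andbT; apply/negP => /(yposs_gt h0 hk'); lia.
Qed.

End Windows.

Section Stages.
Variables (X Y Z : flow N).
Hypothesis hXYZ : heisenberg X Y Z.
Variables (m h s0 : nat).
Local Notation xpos := (xpos h s0).
Local Notation ypos := (ypos m h s0).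
Local Notation xruns := (xruns h s0).
Local Notation yposs := (yposs m h s0).

Fixpoint stages k : contraction N :=
  if k is k'.+1 then
    comp_contr (average X (iota (xpos k') h)) (comp_contr (half_step Y (ypos k')) (stages k'))
  else id_contr N.

Lemma stages_comm (S : contraction N) k :
  (forall a, commuting S (X a)) -> (forall a, commuting S (Y a)) -> commuting S (stages k).
Proof.
move=> hX hY; elim: k => [|k IH] //=.
apply: commuting_comp; first exact: commuting_average.
by apply: commuting_comp => //; apply: commuting_mid.
Qed.

Lemma half_diff_commuting (W : flow N) i a : commute_flows W Z -> commuting (half_diff Z i) (W a).
Proof. by move=> hW; apply/commuting_sym/commuting_mid => //; apply: commuting_opp. Qed.

(** Compares the product of all averages in [X] followed by all averages in [Y]
with the product in which they are interleaved stage by stage.  The [X] runs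
that must cross [Y^(2^(ypos k))] have total weight at most [2^(xpos k - h)], so
the commutator is a power of [Z] of exponent at most [2^(m - h)]. *)
Lemma stages_approx k tau w : (xpos k <= m)%N -> N (Z 1%N w - w) <= tau ->
  N (average X (xruns k) (average Y (yposs k) w) - stages k w) <=
    k%:R * (2 ^+ m * 2^-1 ^+ h * tau).
Proof.
have [hXZ hYZ _] := hXYZ.
move=> + hw; have t0 : 0 <= tau by exact: le_trans (snorm_ge0 _ _) hw.
elim: k => [|k IH] hk; first by rewrite /= subrr snorm0 mul0r.
have hk' : (xpos k <= m)%N by apply: leq_trans hk; rewrite /xpos; lia.
rewrite [xruns _]/= average_cat -addn1 natrD mulrDl mul1r [leRHS]addrC.
set A := average X (xruns k); set w' := average Y (yposs k) w.
apply: le_trans (snorm_dist_triangle N (average X (iota (xpos k) h) (half_step Y (ypos k) (A w'))) _ _) _.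
apply: lerD.
  rewrite addn1 -[average Y (yposs k.+1) w]/(half_step Y (ypos k) w') -contrB.
  apply: le_trans (contraction_le _ _) _.
  have hw' : N (Z 1%N w' - w') <= tau.
    have c : commuting (Z 1%N) (average Y (yposs k)).
      by apply: commuting_average => a; exact/commuting_sym/hYZ.
    by rewrite c -contrB; apply: le_trans (contraction_le _ _) hw.
  have := average_commutator (xruns k) [:: ypos k] hXYZ hw'.
  rewrite {2}/binary_weight big_seq1 => h1; apply: le_trans h1 _.
  apply: ler_wpM2r => //.
  rewrite exprVn ler_pdivlMr ?exprn_gt0 // -!natrX -natrM ler_nat.
  rewrite mulnAC; apply: leq_trans (leq_mul (binary_weight_xruns h s0 k) (leqnn _)) _.
  by rewrite -expnD leq_exp2l // /ypos; lia.
rewrite addn1 -[stages k.+1 w]/(average X (iota (xpos k) h) (half_step Y (ypos k) (stages k w))).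
rewrite -!contrB; apply: le_trans (contraction_le _ _) _; apply: le_trans (contraction_le _ _) _.
exact: IH.
Qed.


Variable eta : R.
Hypotheses (gap : midpoint_gap N 32^-1 eta) (eta0 : 0 < eta) (eta1 : eta <= 1).

Definition rate : R := Num.max (1 - eta) (4 / 7).

Lemma rate_lt1 : rate < 1.
Proof. by rewrite gt_max ltrBlDr ltrDl eta0 /= ltr_pdivrMr ?ltr0n // mul1r ltr_nat. Qed.
Lemma rate_ge : 4 / 7 <= rate. Proof. by rewrite le_max lexx orbT. Qed.
Lemma rate_ge0 : 0 <= rate. Proof. by have := rate_ge; lra. Qed.
Lemma rate_eta : 1 - eta <= rate. Proof. by rewrite le_max lexx. Qed.

(** Each stage either contracts by the factor [1 - eta], or shows that
[half_diff] at level [m + j] is small on the current vector, in which case the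
norm is at most [4/7] of the norm for level [m + j + 1].  The level can rise [h
- j] times, so a stage gains the factor [rate] in both cases. *)
Lemma stages_gain k j w : (xpos k <= m)%N -> (j <= h)%N ->
  N (stages k (half_diff Z (m + j) w)) <= rate ^+ minn k (h - j) * N w.
Proof.
have [hXZ hYZ _] := hXYZ.
have r0 := rate_ge0; have r1 : rate <= 1 by rewrite ltW ?rate_lt1.
elim: k j => [|k IH] j hk hj.
  by rewrite min0n expr0 mul1r; exact: contraction_le (half_diff Z _) _.
have hk' : (xpos k <= m)%N by apply: leq_trans hk; rewrite /xpos; lia.
move: hj; rewrite leq_eqVlt => /orP[/eqP->|hj].
  rewrite subnn minn0 expr0 mul1r.
  exact: le_trans (contraction_le (stages _) _) (contraction_le (half_diff Z _) _).
set u := stages k (half_diff Z (m + j) w).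
rewrite -[stages k.+1 _]/(average X (iota (xpos k) h) (half_step Y (ypos k) u)).
case: (lerP (N (average X (iota (xpos k) h) (half_step Y (ypos k) u))) ((1 - eta) * N u)).
  move=> hu; apply: le_trans hu _.
  apply: (@le_trans _ _ (rate * (rate ^+ minn k (h - j) * N w))).
    apply: ler_pM; rewrite ?subr_ge0 ?snorm_ge0 ?rate_eta //.
    exact: IH (ltnW hj).
  rewrite mulrA -exprS ler_wpM2r ?snorm_ge0 //.
  by apply: ler_wiXn2l => //; lia.
move=> hu.
have mem : (xpos k + j)%N \in iota (xpos k) h by rewrite mem_iota; lia.
(* The scale 1/32 gives 4/32 = 1/8 in [stage_dichotomy], and 4/7 = 1 / (2 (1 -
1/8)). *)
have e0 : (0:R) <= 32^-1 by rewrite invr_ge0.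
have := stage_dichotomy gap e0 eta1 hXYZ mem hu.
have -> : (xpos k + j + ypos k = m + j)%N by rewrite /ypos; lia.
move=> hP.
have IHj := IH j.+1 hk' hj; rewrite addnS in IHj.
have eu : u = 2^-1 *: stages k (half_diff Z (m + j).+1 w) + half_diff Z (m + j) u.
  rewrite {1}/u half_diff_level contrD contrZ; congr (_ + _).
  by rewrite /u (stages_comm k (S := half_diff Z (m + j))) // => a;
     apply: half_diff_commuting.
have hu2 := snormD N (2^-1 *: stages k (half_diff Z (m + j).+1 w)) (half_diff Z (m + j) u).
rewrite -eu snorm_half in hu2.
have huj : N u <= 4 / 7 * (rate ^+ minn k (h - j.+1) * N w) by lra.
apply: (@le_trans _ _ (N u)); first exact: le_trans (contraction_le _ _) (contraction_le _ _).
apply: le_trans huj _.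
have -> : minn k.+1 (h - j) = (minn k (h - j.+1)).+1.
  by rewrite -minnSS -subSn // subSS.
rewrite exprS -[leRHS]mulrA; apply: ler_wpM2r; last exact: rate_ge.
by rewrite mulr_ge0 ?snorm_ge0 ?exprn_ge0 ?rate_ge0.
Qed.

End Stages.

Definition annulus_rate eta h : R := rate eta ^+ h + h%:R * (2 * 2^-1 ^+ h).

(** The windows of [X] and [Y] are long enough to contain the [h] stages of some
placement [s0]; the remaining factors are contractions which commute out to the
left and to the right. *)
Lemma annulus_decay eta X Y Z m h dX dY v :
  midpoint_gap N 32^-1 eta -> 0 < eta <= 1 -> heisenberg X Y Z -> (0 < h)%N ->
  (h * (h + h) <= dX)%N -> (h * (h + h) < dY)%N -> (h * (h + h) <= m)%N ->
  (m + h * (h + h) < dX + dY)%N ->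
  N (box X dX (box Y dY (half_diff Z m (box Z m v)))) <= annulus_rate eta h * N v.
Proof.
move=> gap /andP[eta0 eta1] hh h0 hX hY hm hmXY.
have [hXZ hYZ _] := hh.
(* The smallest offset for which the first [Y] position [m - s0] is below [dY].
*)
pose s0 := (m.+1 - dY)%N; pose I := xruns h s0 h; pose J := yposs m h s0 h.
have hpos : (xpos h s0 h <= m)%N by rewrite /xpos /s0; lia.
have Jlt : {in J, forall t, (t < dY)%N}.
  by move=> t /(yposs_gt h0 hpos); rewrite /s0; lia.
have Ilt : {in I, forall s, (s < dX)%N}.
  by move=> s /xruns_lt; rewrite /xpos /s0; lia.
rewrite (box_sub _ _ (xruns_uniq h s0 h) Ilt).
rewrite (average_commute _ _ (commute_flows_refl X)); apply: le_trans (contraction_le _ _) _.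
rewrite (box_sub _ _ (yposs_uniq h0 hpos) Jlt).
set J' := seq.filter _ _; set v' := average Y J' v.
have -> : average Y J' (half_diff Z m (box Z m v)) = half_diff Z m (box Z m v').
  have c1 : commuting (half_diff Z m) (average Y J') by apply: commuting_average => a; apply: half_diff_commuting.
  by rewrite -c1 /v' /box (average_commute _ _ hYZ).
have hv' : N v' <= N v := contraction_le _ _.
set w := box Z m v'.
have hw : N (Z 1%N (half_diff Z m w) - half_diff Z m w) <= 2 * 2^-1 ^+ m * N v'.
  have c1 : commuting (half_diff Z m) (Z 1%N) by apply/half_diff_commuting/commute_flows_refl.
  rewrite -c1 -contrB; apply: le_trans (contraction_le _ _) _.
  by have := flow_box_le Z m 1 v'; rewrite mul1r.
have D := stages_approx hh hpos hw.
have G := stages_gain hh gap eta0 eta1 w hpos (leq0n h).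
rewrite addn0 subn0 minnn in G.
have := snormD N (average X I (average Y J (half_diff Z m w)) - stages X Y m h s0 h (half_diff Z m w))
  (stages X Y m h s0 h (half_diff Z m w)).
rewrite subrK => /le_trans; apply.
rewrite /annulus_rate mulrDl [leRHS]addrC; apply: lerD.
  apply: le_trans D _; rewrite -[leRHS]mulrA; apply: ler_wpM2l => //.
  have -> : 2 ^+ m * 2^-1 ^+ h * (2 * 2^-1 ^+ m * N v') = 2 * 2^-1 ^+ h * N v'.
    by rewrite [2^-1 ^+ m]exprVn; field; rewrite expf_neq0 ?pnatr_eq0.
  by apply: ler_wpM2l hv'; rewrite mulr_ge0 ?exprn_ge0 ?invr_ge0.
apply: le_trans G _; apply: ler_wpM2l; first by rewrite exprn_ge0 ?rate_ge0.
exact: le_trans (contraction_le _ _) hv'.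
Qed.

End Heisenberg.

(** * Words of averages over six roots *)

Section Raise.
Local Open Scope ring_scope.
Variables (R : rcfType) (V : lmodType R) (N : seminorm V).
Implicit Types (X Y Z : flow N) (u v w : V) (S T : contraction N).

Definition close_contr S T c := forall v, N (S v - T v) <= c * N v.

Lemma close_contr_sym S T c : close_contr S T c -> close_contr T S c.
Proof. by move=> h v; rewrite snorm_distC. Qed.

Lemma close_contr_trans T S U c d : close_contr S T c -> close_contr T U d -> close_contr S U (c + d).
Proof.
by move=> h k v; rewrite mulrDl (le_trans (snorm_dist_triangle _ (T v) _ _)) ?lerD.
Qed.

Lemma close_contr_le S T c d : c <= d -> close_contr S T c -> close_contr S T d.
Proof. by move=> cd h v; apply: le_trans (h v) _; rewrite ler_wpM2r ?snorm_ge0. Qed.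

Lemma annulus_rate_ge0 (eta : R) h : 0 <= annulus_rate eta h.
Proof. by rewrite /annulus_rate addr_ge0 ?exprn_ge0 ?rate_ge0 // mulr_ge0 // mulr_ge0 ?exprn_ge0 ?invr_ge0. Qed.

Lemma box_drop Z i v : box Z i v - box Z i.+1 v = half_diff Z i (box Z i v).
Proof.
have -> : half_diff Z i (box Z i v) = box Z i (half_diff Z i v).
  have c : commuting (half_diff Z i) (box Z i).
    by apply: commuting_average => a; apply/half_diff_commuting/commute_flows_refl.
  exact: c.
rewrite boxS -contrB; congr (box Z i _) => /=.
have e : v = 2^-1 *: v + 2^-1 *: v.
  by rewrite -scalerDl -[2^-1]mul1r -splitr scale1r.
by rewrite scalerDr {1}e addrKA scalerBr.
Qed.

Section Levels.
Variables (eta : R) (X Y Z : flow N) (h dX dY : nat).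
Hypotheses (gap : midpoint_gap N 32^-1 eta) (eta01 : 0 < eta <= 1).
Hypothesis hXYZ : heisenberg X Y Z.
Hypotheses (h0 : (0 < h)%N).
Hypotheses (hX : (h * (h + h) <= dX)%N) (hY : (h * (h + h) < dY)%N).

(** Telescoping in the level of [Z], one annulus at a time. *)
Lemma raise_by n c :
  (h * (h + h) <= c)%N -> (c + n + h * (h + h) <= dX + dY)%N ->
  close_contr (comp_contr (box X dX) (comp_contr (box Z c) (box Y dY)))
        (comp_contr (box X dX) (comp_contr (box Z (c + n)) (box Y dY)))
        (n%:R * annulus_rate eta h).
Proof.
move=> hc; elim: n => [|n IH] hn.
  by move=> v; rewrite addn0 subrr snorm0 mul0r mul0r.
rewrite -natr1 mulrDl mul1r.
apply: close_contr_trans (IH _) _; first lia.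
move=> v; rewrite addnS /= -!contrB box_drop.
have [_ hYZ _] := hXYZ.
have c1 : commuting (half_diff Z (c + n)) (box Y dY).
  by apply: commuting_average => a; apply: half_diff_commuting.
rewrite /box -(average_commute _ _ hYZ) -/(box _ _) c1.
by apply: annulus_decay => //; lia.
Qed.

(** In a product of averages the level of the central letter is irrelevant
within the range that its two neighbours control. *)
Lemma raise c c' M :
  (h * (h + h) <= c <= M)%N -> (h * (h + h) <= c' <= M)%N ->
  (c + h * (h + h) <= dX + dY)%N -> (c' + h * (h + h) <= dX + dY)%N ->
  close_contr (comp_contr (box X dX) (comp_contr (box Z c) (box Y dY)))
        (comp_contr (box X dX) (comp_contr (box Z c') (box Y dY)))
        (M%:R * annulus_rate eta h).
Proof.
wlog cc : c c' / (c <= c')%N => [hw h1 h2 h3 h4|].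
  have [cc|/ltnW cc] := leqP c c'; first exact: hw.
  by apply: close_contr_sym; apply: hw.
move=> h1 h2 h3 h4; rewrite -(subnKC cc).
apply: close_contr_le (raise_by (n := (c' - c)%N) (c := c) _ _); [|lia|lia].
by apply: ler_wpM2r; [exact: annulus_rate_ge0|rewrite ler_nat; lia].
Qed.

End Levels.

(** When the central level exceeds the sum of the outer levels, the commutator
of the outer averages is absorbed by the central average. *)
Lemma flip X Y Z a b c e : heisenberg X Y Z -> (a + b + e <= c)%N ->
  close_contr (comp_contr (box X a) (comp_contr (box Z c) (box Y b)))
        (comp_contr (box Y b) (comp_contr (box Z c) (box X a))) (2 * 2^-1 ^+ e).
Proof.
move=> hh hc v /=; have [hXZ hYZ _] := hh.
rewrite /box -(average_commute _ _ hYZ) -(average_commute _ _ hXZ) -!/(box _ _).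
have hu : N (Z 1%N (box Z c v) - box Z c v) <= 2 * 2^-1 ^+ c * N v.
  by have := flow_box_le Z c 1 v; rewrite mul1r.
apply: le_trans (average_commutator (iota 0 a) (iota 0 b) hh hu) _.
rewrite mulrA; apply: ler_wpM2r; first exact: snorm_ge0.
rewrite mulrCA; apply: ler_wpM2l => //.
rewrite !exprVn ler_pdivrMr ?exprn_gt0 // mulrC ler_pdivlMr ?exprn_gt0 //.
rewrite -!natrX -natrM ler_nat.
apply: leq_trans (_ : 2 ^ a * 2 ^ b * 2 ^ e <= _)%N; last first.
  by rewrite -!expnD leq_exp2l.
rewrite leq_mul2r; apply/orP; right.
have := binary_weight_iota 0 a; have := binary_weight_iota 0 b; rewrite !add0n expn0.
by move=> <- <-; apply: leq_mul; rewrite leq_addr.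
Qed.

End Raise.

Section Words.
Local Open Scope ring_scope.
Variables (R : rcfType) (V : lmodType R) (N : seminorm V).
Variable U : nat -> flow N.

(** A letter is a root together with a level, the level counted in units of the
scale [e]. *)
Definition word := seq (nat * nat).

Fixpoint word_op (e : nat) (w : word) : contraction N :=
  if w is p :: w' then comp_contr (box (U p.1) (p.2 * e)) (word_op e w') else id_contr N.

Lemma word_op_cat e w1 w2 v : word_op e (w1 ++ w2) v = word_op e w1 (word_op e w2 v).
Proof. by elim: w1 v => //= p w1 IH v; rewrite IH. Qed.

Lemma close_contr_context e l r w w' c : close_contr (word_op e w) (word_op e w') c -> 0 <= c ->
  close_contr (word_op e (l ++ w ++ r)) (word_op e (l ++ w' ++ r)) c.
Proof.
move=> hw c0 v; rewrite !word_op_cat -contrB.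
apply: le_trans (contraction_le _ _) _; apply: le_trans (hw _) _.
by apply: ler_wpM2l => //; exact: contraction_le.
Qed.

(** The letters 0, ..., 5 stand for the roots of [A_2] in cyclic order: each is
the sum of its two neighbours and commutes with both. *)
Definition hexagon := forall k, (k < 6)%N ->
  heisenberg (U k) (U ((k + 2) %% 6)) (U (k.+1 %% 6)).

Variables (eta : R) (h e : nat).
Hypotheses (gap : midpoint_gap N 32^-1 eta) (eta01 : 0 < eta <= 1).
Hypothesis hex : hexagon.
Hypotheses (h0 : (0 < h)%N) (he : (h * (h + h) <= e)%N).

Definition step_err : R := (14 * e)%:R * annulus_rate eta h + 2 * 2^-1 ^+ e.

Lemma step_err_ge0 : 0 <= step_err.
Proof. by rewrite addr_ge0 ?mulr_ge0 ?annulus_rate_ge0 ?exprn_ge0 ?invr_ge0. Qed.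

Lemma raise_step l r i j k a b c c' :
  heisenberg (U i) (U j) (U k) ->
  [&& 0 < c <= 14, 0 < c' <= 14, 0 < a, 1 < b, c < a + b & c' < a + b]%N ->
  close_contr (word_op e (l ++ [:: (i, a); (k, c); (j, b)] ++ r))
        (word_op e (l ++ [:: (i, a); (k, c'); (j, b)] ++ r)) step_err.
Proof.
move=> hh /and5P[hc hc' ha hb /andP[hab hab']].
apply: close_contr_context step_err_ge0.
apply: (@close_contr_le _ _ _ _ _ ((14 * e)%:R * annulus_rate eta h)).
  by rewrite lerDl mulr_ge0 ?exprn_ge0 ?invr_ge0.
have e0 : (0 < e)%N by apply: leq_trans he; rewrite muln_gt0 h0 addn_gt0 h0.
have mono p q : (p <= q)%N -> (p * e <= q * e)%N by move=> ?; apply: leq_mul.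
have := mono _ _ ha; have := mono _ _ hb.
have := mono _ _ hab; have := mono _ _ hab'.
have := mono 1%N c; have := mono 1%N c'.
have := mono c 14%N; have := mono c' 14%N.
move=> ? ? ? ? ? ? ? ?.
by apply: (raise gap eta01 hh h0) => /=; lia.
Qed.

Lemma flip_step l r i j k a b c :
  heisenberg (U i) (U j) (U k) -> (a + b < c)%N ->
  close_contr (word_op e (l ++ [:: (i, a); (k, c); (j, b)] ++ r))
        (word_op e (l ++ [:: (j, b); (k, c); (i, a)] ++ r)) step_err.
Proof.
move=> hh hc; apply: close_contr_context step_err_ge0.
apply: (@close_contr_le _ _ _ _ _ (2 * 2^-1 ^+ e)).
  by rewrite lerDr mulr_ge0 ?annulus_rate_ge0.
have := @flip _ _ _ (U i) (U j) (U k) (a * e) (b * e) (c * e) e hh.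
by apply; nia.
Qed.

(** The central level 7 exceeds 3 + 3, so both triples can be reversed; 3 is
large enough for the moves in the proof of [double_scale] to end with all levels
doubled. *)
Definition hexword : word := [:: (0, 3); (1, 7); (2, 3); (3, 3); (4, 7); (5, 3)]%N.

(** Reverse both triples, so that the letters 0 and 5, which were at the ends,
stand in the middle of the word between their neighbours and can be raised; then
the central letters 1 and 4 can be raised too.  Lowering 0 and 5 a little makes
both triples reversible again; after reversing them back, the same is done with
the letters 2 and 3. *)
Lemma double_scale : close_contr (word_op e hexword) (word_op (2 * e) hexword) (16%:R * step_err).
Proof.
have h012 : heisenberg (U 0) (U 2) (U 1) := hex (k := 0) isT.
have h123 : heisenberg (U 1) (U 3) (U 2) := hex (k := 1) isT.
have h234 : heisenberg (U 2) (U 4) (U 3) := hex (k := 2) isT.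
have h345 : heisenberg (U 3) (U 5) (U 4) := hex (k := 3) isT.
have h450 : heisenberg (U 4) (U 0) (U 5) := hex (k := 4) isT.
have h501 : heisenberg (U 5) (U 1) (U 0) := hex (k := 5) isT.
have -> : word_op (2 * e) hexword = 
  word_op e [:: (0, 6); (1, 14); (2, 6); (3, 6); (4, 14); (5, 6)]%N.
  by rewrite /hexword /= !mulnA.
have C n w1 w2 w3 : close_contr (word_op e w1) (word_op e w2) step_err ->
    close_contr (word_op e w2) (word_op e w3) (n%:R * step_err) ->
    close_contr (word_op e w1) (word_op e w3) (n.+1%:R * step_err).
  by move=> h1 h2; rewrite -natr1 mulrDl mul1r addrC; exact: close_contr_trans h1 h2.
apply: (C _ _ _ _ (flip_step [::] [:: (3, 3); (4, 7); (5, 3)]%N h012 _) _) => //.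
apply: (C _ _ _ _ (flip_step [:: (2, 3); (1, 7); (0, 3)]%N [::] h345 _) _) => //.
apply: (C _ _ _ _ (raise_step [:: (2, 3)]%N [:: (4, 7); (3, 3)]%N (c' := 9) (heisenberg_sym h501) _) _) => //.
apply: (C _ _ _ _ (raise_step [:: (2, 3); (1, 7)]%N [:: (3, 3)]%N (c' := 9) (heisenberg_sym h450) _) _) => //.
apply: (C _ _ _ _ (raise_step [::] [:: (5, 9); (4, 7); (3, 3)]%N (c' := 11) (heisenberg_sym h012) _) _) => //.
apply: (C _ _ _ _ (raise_step [:: (2, 3); (1, 11); (0, 9)]%N [::] (c' := 11) (heisenberg_sym h345) _) _) => //.
apply: (C _ _ _ _ (raise_step [:: (2, 3)]%N [:: (4, 11); (3, 3)]%N (c' := 6) (heisenberg_sym h501) _) _) => //.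
apply: (C _ _ _ _ (raise_step [:: (2, 3); (1, 11)]%N [:: (3, 3)]%N (c' := 6) (heisenberg_sym h450) _) _) => //.
apply: (C _ _ _ _ (flip_step [::] [:: (5, 6); (4, 11); (3, 3)]%N (heisenberg_sym h012) _) _) => //.
apply: (C _ _ _ _ (flip_step [:: (0, 6); (1, 11); (2, 3)]%N [::] (heisenberg_sym h345) _) _) => //.
apply: (C _ _ _ _ (raise_step [:: (0, 6)]%N [:: (4, 11); (5, 6)]%N (c' := 9) h123 _) _) => //.
apply: (C _ _ _ _ (raise_step [:: (0, 6); (1, 11)]%N [:: (5, 6)]%N (c' := 9) h234 _) _) => //.
apply: (C _ _ _ _ (raise_step [::] [:: (3, 9); (4, 11); (5, 6)]%N (c' := 14) h012 _) _) => //.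
apply: (C _ _ _ _ (raise_step [:: (0, 6); (1, 14); (2, 9)]%N [::] (c' := 14) h345 _) _) => //.
apply: (C _ _ _ _ (raise_step [:: (0, 6)]%N [:: (4, 14); (5, 6)]%N (c' := 6) h123 _) _) => //.
apply: (C _ _ _ _ (raise_step [:: (0, 6); (1, 14)]%N [:: (5, 6)]%N (c' := 6) h234 _) _) => //.
by move=> v; rewrite subrr snorm0 mul0r mul0r.
Qed.

End Words.

(** * Convergence of the words and relative property (T) *)

Section Convergence.
Local Open Scope ring_scope.
Variable R : realType.

Lemma geometric_linear (s : R) (h : nat) : 0 <= s < 1 ->
  (1 - s) * (h%:R * s ^+ h) <= 1 - s ^+ h.
Proof.
move=> /andP[s0 s1]; elim: h => [|h IH]; first by rewrite mul0r mulr0 expr0 subrr.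
have p0 : 0 <= s ^+ h by rewrite exprn_ge0.
have p1 : s ^+ h <= 1 by rewrite exprn_ile1 // ltW.
have h1 := ler_wpM2l s0 IH.
have h2 : 0 <= (1 - s) * (1 - s * s ^+ h).
  by rewrite mulr_ge0 ?subr_ge0 ?mulr_ile1 // ltW.
rewrite exprS -natr1.
move: (s ^+ h) (h%:R) h1 h2 => p x; lra.
Qed.

(** Any bound that is summable over the geometric progression of scales would
do; the fourth power turns the polynomial losses, which are cubic in [h], into
an error of order [1 / h]. *)
Lemma geometric_quartic (r : R) : 0 <= r < 1 ->
  exists2 C : R, 0 < C & forall h : nat, h%:R ^+ 4 * r ^+ h <= C.
Proof.
move=> /andP[r0 r1]; pose s := Num.sqrt (Num.sqrt r).
have s0 : 0 <= s by exact: sqrtr_ge0.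
have s4 : s ^+ 4 = r.
  by rewrite (exprM s 2 2) !sqr_sqrtr ?sqrtr_ge0.
have s1 : s < 1.
  by rewrite -(@expr_lt1 _ 4) // s4.
exists ((1 - s)^-1 ^+ 4); first by rewrite exprn_gt0 // invr_gt0 subr_gt0.
move=> h; rewrite -s4 -exprM mulnC exprM -exprMn; apply: lerXn2r.
- by rewrite nnegrE mulr_ge0 ?exprn_ge0.
- by rewrite nnegrE invr_ge0 subr_ge0 ltW.
have := @geometric_linear s h; rewrite s0 s1 => /(_ isT) hl.
rewrite -[leRHS]mulr1 mulrC ler_pdivlMl ?subr_gt0 //.
by rewrite [s ^+ h * _]mulrC; apply: le_trans hl _; rewrite gerBl exprn_ge0.
Qed.

Section Limit.
Variables (eta : R) (V : lmodType R) (N : seminorm V) (U : nat -> flow N).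
Hypotheses (gap : midpoint_gap N 32^-1 eta) (eta01 : 0 < eta <= 1).
Hypothesis hex : hexagon U.

Lemma step_err_le h e : (0 < h)%N -> (h <= e <= 8 * (h * h))%N ->
  step_err eta h e <= 338 * h%:R ^+ 3 * rate eta ^+ h.
Proof.
move=> h0 /andP[he1 he2].
have r0 := rate_ge0 eta; have r1 : rate eta <= 1 by apply/ltW/rate_lt1; case/andP: eta01.
have hr : 2^-1 <= rate eta by have := rate_ge eta; lra.
have p0 : 0 <= rate eta ^+ h by rewrite exprn_ge0.
have q1 : 2^-1 ^+ h <= rate eta ^+ h by apply: lerXn2r; rewrite ?nnegrE ?invr_ge0.
have q2 : 2^-1 ^+ e <= rate eta ^+ h.
  apply: le_trans q1; apply: ler_wiXn2l => //; lra.
have hd : annulus_rate eta h <= 3 * h%:R * rate eta ^+ h.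
  have h1 : 1 <= h%:R :> R by rewrite ler1n.
  have : h%:R * (2 * 2^-1 ^+ h) <= h%:R * (2 * rate eta ^+ h).
    by rewrite ler_wpM2l // ler_wpM2l.
  by rewrite /annulus_rate; nra.
have he3 : (14 * e)%:R <= 112 * h%:R ^+ 2 :> R.
  by rewrite expr2 -!natrM ler_nat; lia.
have h3 : 1 <= h%:R ^+ 3 :> R by rewrite exprn_ege1 // ler1n.
have : (14 * e)%:R * annulus_rate eta h <= 112 * h%:R ^+ 2 * (3 * h%:R * rate eta ^+ h).
  by apply: ler_pM; rewrite ?annulus_rate_ge0.
have h4 : rate eta ^+ h <= h%:R ^+ 3 * rate eta ^+ h by rewrite ler_peMl.
rewrite /step_err; move: h4 q2; move: (rate eta ^+ h) (2^-1 ^+ e) => p q; lra.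
Qed.

(** The Heisenberg estimate with parameter [h] needs windows of length [2 h^2],
so the scale is taken proportional to [h^2]; doubling [h] doubles it twice. *)
Definition scale h : nat := (4 * (h * h))%N.

Lemma scale_double C h : (0 < h)%N -> h%:R ^+ 4 * rate eta ^+ h <= C ->
  close_contr (word_op U (scale h) hexword) (word_op U (scale (2 * h)) hexword)
    (32 * (338 * C) / h%:R).
Proof.
move=> h0 hC.
have c1 : close_contr (word_op U (scale h) hexword) (word_op U (2 * scale h) hexword)
    (16%:R * step_err eta h (scale h)).
  by apply: double_scale => //; rewrite /scale; lia.
have c2 : close_contr (word_op U (2 * scale h) hexword) (word_op U (scale (2 * h)) hexword)
    (16%:R * step_err eta h (2 * scale h)).
  have -> : scale (2 * h) = (2 * (2 * scale h))%N by rewrite /scale; lia.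
  by apply: double_scale => //; rewrite /scale; lia.
apply: close_contr_le (close_contr_trans c1 c2).
have hh : (h <= h * h)%N by rewrite leq_pmulr.
have e1 : step_err eta h (scale h) <= 338 * h%:R ^+ 3 * rate eta ^+ h.
  by apply: step_err_le => //; rewrite /scale; lia.
have e2 : step_err eta h (2 * scale h) <= 338 * h%:R ^+ 3 * rate eta ^+ h.
  by apply: step_err_le => //; rewrite /scale; lia.
rewrite ler_pdivlMr ?ltr0n //.
have hp : 0 <= h%:R :> R by [].
have f1 := ler_wpM2r hp e1; have f2 := ler_wpM2r hp e2.
have m : 338 * h%:R ^+ 3 * rate eta ^+ h * h%:R = 338 * (h%:R ^+ 4 * rate eta ^+ h).
  by ring.
by rewrite m in f1 f2; lra.
Qed.

End Limit.

Section Telescoping.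
Variables (V : lmodType R) (N : seminorm V) (U : nat -> flow N).

(** The errors of successive doublings form a geometric series of ratio 1/2. *)
Lemma scale_far D h j : 0 <= D ->
  (forall h, (0 < h)%N ->
    close_contr (word_op U (scale h) hexword) (word_op U (scale (2 * h)) hexword) (D / h%:R)) ->
  (0 < h)%N ->
  close_contr (word_op U (scale h) hexword) (word_op U (scale (2 ^ j * h)) hexword)
    (2 * (D / h%:R)).
Proof.
move=> D0 hD; elim: j h => [|j IH] h h0.
  move=> v; rewrite expn0 mul1n subrr snorm0 mulr_ge0 ?snorm_ge0 // mulr_ge0 //.
  by rewrite divr_ge0.
have h20 : (0 < 2 * h)%N by lia.
rewrite expnSr -mulnA.
apply: close_contr_le (close_contr_trans (hD _ h0) (IH (2 * h)%N h20)).
rewrite natrM invfM; move: (h%:R^-1) => y.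
by rewrite le_eqVlt; apply/orP; left; apply/eqP; field.
Qed.

Lemma word_displacement e w v d : (forall p, p \in w -> N (U p.1 1%N v - v) <= d) ->
  N (word_op U e w v - v) <= (\sum_(p <- w) 2 ^+ (p.2 * e)%N) * d.
Proof.
elim: w => [|p w IH] hw; first by rewrite big_nil mul0r subrr snorm0.
rewrite big_cons mulrDl [leRHS]addrC /=.
apply: le_trans (snorm_dist_triangle N (box (U p.1) (p.2 * e) v) _ _) _.
rewrite -contrB; apply: lerD.
  apply: le_trans (contraction_le _ _) _; apply: IH => q qw.
  by apply: hw; rewrite inE qw orbT.
apply: le_trans (box_displacement _ _ _) _; rewrite ler_wpM2l ?exprn_ge0 //.
by apply: hw; rewrite mem_head.
Qed.

End Telescoping.

(** The constant depends on the convexity modulus alone, neither on the space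
nor on the action. *)
Lemma scale_limit (eta : R) : 0 < eta <= 1 -> exists2 D : R, 0 < D &
  forall (V : lmodType R) (N : seminorm V) (U : nat -> flow N),
  midpoint_gap N 32^-1 eta -> hexagon U -> forall h j, (0 < h)%N ->
  close_contr (word_op U (scale h) hexword) (word_op U (scale (2 ^ j * h)) hexword) (D / h%:R).
Proof.
move=> eta01.
have rate01 : 0 <= rate eta < 1.
  by rewrite rate_ge0 rate_lt1 //; case/andP: eta01.
have [C C0 hC] := geometric_quartic rate01.
have D0 : 0 < 32 * (338 * C) :=
  mulr_gt0 (ltr0Sn R 31) (mulr_gt0 (ltr0Sn R 337) C0).
exists (2 * (32 * (338 * C))); first by rewrite mulr_gt0.
move=> V N U gap hex h j h0; rewrite -mulrA; apply: scale_far (ltW D0) _ h0.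
by move=> h' h'0; apply: (scale_double gap eta01 hex).
Qed.

(** Choose [h] so large that the word at scale [h] is [eps / 4]-close to the
words at all larger scales, then let the scale tend to infinity for a given
power [t]: the larger words start with an average over the letter 0 which
absorbs [t].  The constant [K] accounts for the cost of the word at the fixed
scale [h]. *)
Theorem relative_invariance (eta : R) : 0 < eta <= 1 ->
  forall eps : R, 0 < eps -> exists2 K : R, 0 <= K &
  forall (V : lmodType R) (N : seminorm V) (U : nat -> flow N),
  midpoint_gap N 32^-1 eta -> hexagon U ->
  forall (v : V) (d : R), (forall k, (k < 6)%N -> N (U k 1%N v - v) <= d) ->
  forall t, N (U 0%N t v - v) <= K * d + eps * N v.
Proof.
move=> eta01 eps eps0.
have [D D0 hD] := scale_limit eta01.
have [h h0 hh] : exists2 h : nat, (0 < h)%N & D / h%:R <= eps / 4.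
  exists (Num.bound (4 * D / eps)).+1 => //.
  have : 4 * D / eps < (Num.bound (4 * D / eps)).+1%:R.
    apply: lt_le_trans (archi_boundP _) _; last by rewrite ler_nat.
    by rewrite divr_ge0 ?mulr_ge0 ?(ltW D0) ?(ltW eps0).
  by rewrite ltr_pdivrMr // ler_pdivrMr ?ltr0n // => hb; lra.
pose A : R := \sum_(p <- hexword) 2 ^+ (p.2 * scale h)%N.
have A0 : 0 <= A by apply: sumr_ge0 => p _; rewrite exprn_ge0.
exists (2 * A); first by rewrite mulr_ge0.
move=> V N U gap hex v d hd t.
have hw : N (word_op U (scale h) hexword v - v) <= A * d.
  apply: word_displacement => p; rewrite !inE => hp; apply: hd.
  by move: hp; do 6 ?[case/orP; [by move/eqP=> ->|]]; move/eqP=> ->.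
(* The word at scale [2^j h] starts with an average over the letter 0 of length
at least [2^j]. *)
pose j := Num.bound (4 * t%:R / eps).
have hj : t%:R * 2 * 2^-1 ^+ j <= eps / 2.
  have : 4 * t%:R / eps < j%:R by apply: archi_boundP; rewrite divr_ge0 ?mulr_ge0 ?(ltW eps0).
  have : j%:R <= 2 ^+ j :> R by rewrite -natrX ler_nat ltnW // ltn_expl.
  move=> h1 h2; have := lt_le_trans h2 h1.
  rewrite ltr_pdivrMr // exprVn ler_pdivrMr ?exprn_gt0 //; lra.
pose T := word_op U (scale (2 ^ j * h)) hexword.
have hT : N (v - T v) <= A * d + eps / 4 * N v.
  apply: le_trans (snorm_dist_triangle N (word_op U (scale h) hexword v) _ _) _.
  rewrite [N (v - _)]snorm_distC; apply: lerD hw _.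
  apply: le_trans (hD _ _ _ gap hex h j h0 v) _.
  by rewrite ler_wpM2r ?snorm_ge0.
have hT2 : N (U 0%N t (T v) - T v) <= eps / 2 * N v.
  rewrite /T /=; set w := box (U 1%N) _ _.
  have ww : N w <= N v by do 4! apply: le_trans (contraction_le _ _) _; exact: contraction_le.
  apply: le_trans (flow_box_le _ _ _ _) _.
  apply: ler_pM ww; rewrite ?snorm_ge0 ?mulr_ge0 ?exprn_ge0 ?invr_ge0 //.
  apply: le_trans hj; rewrite ler_wpM2l ?mulr_ge0 //.
  apply: ler_wiXn2l; [lra|lra|].
  rewrite /scale; have : (j < 2 ^ j)%N by rewrite ltn_expl.
  have : (2 ^ j <= 2 ^ j * h)%N by rewrite leq_pmulr.
  move: (2 ^ j * h)%N => x; nia.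
have := snorm_dist_triangle N (U 0%N t (T v)) (U 0%N t v) v.
have := snorm_dist_triangle N (T v) (U 0%N t (T v)) v.
rewrite -contrB flow_isometry [N (T v - v)]snorm_distC.
lra.
Qed.

End Convergence.

(** * Uniform convexity of l2 sums *)

Section L2.
Local Open Scope ring_scope.
Variables (R : realType) (E : completeNormedModType R) (N : E -> R).
Hypothesis normN : is_norm N.

Let ND x y : N (x + y) <= N x + N y. Proof. by case: normN. Qed.
Let NZ (a : R) x : N (a *: x) = `|a| * N x. Proof. by case: normN. Qed.
Definition norm_seminorm : seminorm E := Seminorm ND NZ.
Let Nge0 x : 0 <= N x. Proof. exact: (snorm_ge0 norm_seminorm). Qed.
Let NBC x y : N (x - y) = N (y - x). Proof. exact: (snorm_distC norm_seminorm). Qed.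

Variable T : finType.
Implicit Types f g : {ffun T -> E}.

Definition l2 (f : {ffun T -> E}) : R := Num.sqrt (\sum_x N (f x) ^+ 2).

Lemma l2_sqr f : l2 f ^+ 2 = \sum_x N (f x) ^+ 2.
Proof. by rewrite sqr_sqrtr // sumr_ge0 // => x _; rewrite sqr_ge0. Qed.

Lemma l2_ge0 f : 0 <= l2 f. Proof. exact: sqrtr_ge0. Qed.

Lemma l2_le f (c : R) : 0 <= c -> \sum_x N (f x) ^+ 2 <= c ^+ 2 -> l2 f <= c.
Proof.
move=> c0 h; rewrite -(@ler_pXn2r _ 2) ?nnegrE ?l2_ge0 //.
by rewrite l2_sqr.
Qed.

Lemma l2_eq0 f x : l2 f = 0 -> N (f x) = 0.
Proof.
move=> f0; have := l2_sqr f; rewrite f0 expr0n /= => /esym/eqP.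
rewrite psumr_eq0 => [/allP/(_ x (mem_index_enum x))|y _]; last exact: sqr_ge0.
by rewrite /= sqrf_eq0 => /eqP.
Qed.

Lemma l2Z (a : R) f : l2 (a *: f) = `|a| * l2 f.
Proof.
rewrite /l2 -[`|a|]sqrtr_sqr -sqrtrM ?sqr_ge0 // mulr_sumr.
congr Num.sqrt; apply: eq_bigr => x _.
by rewrite ffunE NZ exprMn real_normK ?num_real.
Qed.

(** For positive [A] and [B], [(a + b)^2 <= (A + B) (a^2 / A + b^2 / B)]; summed
over the coordinates with [A] and [B] the two norms, this is Minkowski's
inequality. *)
Lemma l2D f g : l2 (f + g) <= l2 f + l2 g.
Proof.
have [f0|fn0] := eqVneq (l2 f) 0.
  rewrite f0 add0r; apply: l2_le (l2_ge0 _) _; rewrite l2_sqr.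
  apply: ler_sum => x _; apply: lerXn2r; rewrite ?nnegrE ?Nge0 //.
  by rewrite ffunE; apply: le_trans (ND _ _) _; rewrite (l2_eq0 x f0) add0r.
have [g0|gn0] := eqVneq (l2 g) 0.
  rewrite g0 addr0; apply: l2_le (l2_ge0 _) _; rewrite l2_sqr.
  apply: ler_sum => x _; apply: lerXn2r; rewrite ?nnegrE ?Nge0 //.
  by rewrite ffunE; apply: le_trans (ND _ _) _; rewrite (l2_eq0 x g0) addr0.
have A0 : 0 < l2 f by rewrite lt_neqAle eq_sym fn0 l2_ge0.
have B0 : 0 < l2 g by rewrite lt_neqAle eq_sym gn0 l2_ge0.
apply: l2_le; first by rewrite addr_ge0 ?l2_ge0.
have hf := l2_sqr f; have hg := l2_sqr g.
move: (l2 f) (l2 g) A0 B0 hf hg {fn0 gn0} => A B A0 B0 hf hg.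
have -> : (A + B) ^+ 2 =
    \sum_x (A + B) * (N (f x) ^+ 2 / A + N (g x) ^+ 2 / B).
  rewrite -mulr_sumr big_split /= -!mulr_suml -hf -hg.
  by field; rewrite !gt_eqF.
apply: ler_sum => x _; rewrite ffunE.
have := ND (f x) (g x); have := Nge0 (f x + g x).
move: (N (f x + g x)) (N (f x)) (N (g x)) => s a b s0 sab.
apply: (@le_trans _ _ ((a + b) ^+ 2)).
  by apply: lerXn2r; rewrite ?nnegrE //; apply: le_trans sab.
rewrite -subr_ge0.
have -> : (A + B) * (a ^+ 2 / A + b ^+ 2 / B) - (a + b) ^+ 2 =
   (a * B - b * A) ^+ 2 / (A * B) by field; rewrite !gt_eqF.
by rewrite divr_ge0 ?sqr_ge0 // mulr_ge0 // ltW.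
Qed.

Definition l2_seminorm : seminorm {ffun T -> E} := Seminorm l2D l2Z.

End L2.

Section UniformConvexity.
Local Open Scope ring_scope.
Variables (R : realType) (E : completeNormedModType R) (N : E -> R).
Hypothesis normN : is_norm N.
Hypothesis ucN : uniformly_convex N.

(** A form of uniform convexity that is linear in squares of norms, so it can be
summed over the coordinates of a function.  If [N (x - y)^2] is below the
threshold it is plain convexity.  Otherwise either the norms of [x] and [y]
differ substantially and strict convexity of the square gains, or the normalized
vectors are far apart and uniform convexity applies. *)
Lemma midpoint_sqr (theta : R) : 0 < theta <= 1 -> exists2 c : R, 0 < c <= 8^-1 &
  forall x y, N (2^-1 *: (x + y)) ^+ 2 <= (N x ^+ 2 + N y ^+ 2) / 2
     - c * (N (x - y) ^+ 2 - theta * (N x ^+ 2 + N y ^+ 2)).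
Proof.
move=> /andP[th0 th1].
have [ND NZ _] := normN.
have Nge0 x : 0 <= N x by exact: (snorm_ge0 (norm_seminorm normN)).
have NBC x y : N (x - y) = N (y - x) by exact: (snorm_distC (norm_seminorm normN)).
have NNN x : N (- x) = N x by exact: (snormN (norm_seminorm normN)).
pose s := Num.sqrt theta.
have s0 : 0 < s by rewrite sqrtr_gt0.
have ss : s ^+ 2 = theta by rewrite sqr_sqrtr // ltW.
have s1 : s <= 1 by rewrite -(@ler_pXn2r _ 2) ?nnegrE ?(ltW s0) // ss expr1n.
have [dl hdl] := ucN.
have [|/andP[d0 d1] hd] := hdl (s / 2); first by apply/andP; split; lra.
set d := dl (s / 2) in d0 d1 hd.
exists (Num.min ((s / 2) ^+ 2 / 16) (d / 8)).
  apply/andP; split; last by rewrite ge_min; apply/orP; right; lra.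
  by rewrite lt_min divr_gt0 ?exprn_gt0 ?divr_gt0.
have c1 : Num.min ((s / 2) ^+ 2 / 16) (d / 8) <= (s / 2) ^+ 2 / 16 by rewrite ge_min lexx.
have c2 : Num.min ((s / 2) ^+ 2 / 16) (d / 8) <= d / 8 by rewrite ge_min lexx orbT.
have c0 : 0 < Num.min ((s / 2) ^+ 2 / 16) (d / 8).
  by rewrite lt_min divr_gt0 ?exprn_gt0 ?divr_gt0.
move: (Num.min _ _) c0 c1 c2 => c c0 c1 c2.
move=> x y.
wlog hab : x y / N y <= N x.
  move=> hw; have [hxy|/ltW hxy] := leP (N y) (N x); first exact: hw.
  by have := hw y x hxy; rewrite [y + x]addrC NBC [N y ^+ 2 + _]addrC.
have hm : N (2^-1 *: (x + y)) <= (N x + N y) / 2.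
  by rewrite NZ ger0_norm ?invr_ge0 // mulrC; have := ND x y; lra.
have m0 := Nge0 (2^-1 *: (x + y)).
have D0 := Nge0 (x - y).
have hD : N (x - y) <= N x + N y by have := ND x (- y); rewrite NNN.
have a0 := Nge0 x; have b0 := Nge0 y.
have [small|big] := leP (N (x - y) ^+ 2) (theta * (N x ^+ 2 + N y ^+ 2)).
  have : N (2^-1 *: (x + y)) ^+ 2 <= ((N x + N y) / 2) ^+ 2.
    by apply: lerXn2r; rewrite ?nnegrE ?divr_ge0 ?addr_ge0.
  have : 0 <= (N x - N y) ^+ 2 by exact: sqr_ge0.
  have : 0 <= c * (theta * (N x ^+ 2 + N y ^+ 2) - N (x - y) ^+ 2).
    by rewrite mulr_ge0 ?subr_ge0 // ltW.
  nra.
suff key : N (2^-1 *: (x + y)) ^+ 2 <= (N x ^+ 2 + N y ^+ 2) * (2^-1 - 2 * c).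
  apply: le_trans key _.
  have h1 : N (x - y) ^+ 2 <= 2 * (N x ^+ 2 + N y ^+ 2).
    apply: (@le_trans _ _ ((N x + N y) ^+ 2)).
      by apply: lerXn2r; rewrite ?nnegrE ?addr_ge0.
    by have := sqr_ge0 (N x - N y); nra.
  have h2 : 0 <= c * (theta * (N x ^+ 2 + N y ^+ 2)).
    by rewrite !mulr_ge0 ?addr_ge0 ?sqr_ge0 // ltW.
  have h3 : c * N (x - y) ^+ 2 <= c * (2 * (N x ^+ 2 + N y ^+ 2)).
    by rewrite ler_wpM2l // ltW.
  lra.
have aD : s * N x <= N (x - y).
  rewrite -(@ler_pXn2r _ 2) ?nnegrE ?mulr_ge0 ?(ltW s0) // exprMn ss.
  apply: le_trans (ltW big); rewrite ler_wpM2l ?(ltW th0) //.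
  by rewrite lerDl sqr_ge0.
have ap : 0 < N x.
  rewrite lt_neqAle a0 andbT; apply/eqP => x0; move: big.
  have y0 : N y = 0 by apply/eqP; rewrite eq_le b0 andbT x0.
  rewrite -x0 y0 expr0n /= addr0 mulr0.
  have -> : N (x - y) = 0 by apply/eqP; rewrite eq_le D0 andbT; move: hD; rewrite -x0 y0 addr0.
  by rewrite expr0n ltxx.
(* Here [y] is shorter than [x] by a definite factor; in the second case the
normalized vectors are at distance at least [s / 2]. *)
have [bs|bb] := ltP (N y) ((1 - s / 2) * N x).
  have : N (2^-1 *: (x + y)) ^+ 2 <= ((N x + N y) / 2) ^+ 2.
    by apply: lerXn2r; rewrite ?nnegrE ?divr_ge0 ?addr_ge0.
  have : (s / 2 * N x) ^+ 2 <= (N x - N y) ^+ 2.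
    apply: lerXn2r; rewrite ?nnegrE ?mulr_ge0 ?subr_ge0 ?divr_ge0 ?(ltW s0) //; lra.
  have : N y ^+ 2 <= N x ^+ 2 by apply: lerXn2r; rewrite ?nnegrE.
  have : c * (N x ^+ 2 + N y ^+ 2) <= (s / 2) ^+ 2 / 16 * (N x ^+ 2 + N y ^+ 2).
    by rewrite ler_wpM2r // addr_ge0 ?sqr_ge0.
  rewrite [(s / 2 * _) ^+ 2]exprMn; have := sqr_ge0 (s / 2).
  move: ((s / 2) ^+ 2) => S S0 h1 h2 h3 h4.
  have := mulr_ge0 S0 (_ : 0 <= N x ^+ 2 - N y ^+ 2).
  rewrite subr_ge0 => /(_ h2); move: h1 h3 h4.
  by move: (N (2^-1 *: _) ^+ 2) => M; lra.
have bp : 0 < N y by apply: lt_le_trans bb; rewrite mulr_gt0 //; lra.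
have b3 : N x <= 2 * N y.
  have : 2^-1 * N x <= (1 - s / 2) * N x by rewrite ler_wpM2r //; lra.
  by lra.
pose x' := (N x)^-1 *: x; pose y' := (N y)^-1 *: y.
have nx' : N x' = 1 by rewrite NZ ger0_norm ?invr_ge0 // mulVf // gt_eqF.
have ny' : N y' = 1 by rewrite NZ ger0_norm ?invr_ge0 // mulVf // gt_eqF.
have far : s / 2 <= N (x' - y').
  have e : x - y = N x *: (x' - y') + (N x - N y) *: y'.
    rewrite scalerBl scalerBr /x' /y' !scalerA !divff ?gt_eqF // !scale1r.
    by rewrite addrA subrK.
  have := ND (N x *: (x' - y')) ((N x - N y) *: y').
  rewrite -e (NZ (N x)) (NZ (N x - N y)) !ger0_norm ?subr_ge0 // ny' mulr1 => h.
  rewrite -(ler_pM2l ap); lra.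
have mid : N (2^-1 *: (x + y)) <= (N x + N y) / 2 - N y * d.
  have e : 2^-1 *: (x + y) = N y *: (2^-1 *: (x' + y')) + (N x - N y) *: (2^-1 *: x').
    rewrite !scalerA ![_ * 2^-1]mulrC -!scalerA -scalerDr; congr (_ *: _).
    rewrite scalerBl scalerDr /x' /y' [N x *: _]scalerA [N y *: (_ *: y)]scalerA !divff ?gt_eqF // !scale1r.
    by rewrite [x - _]addrC addrACA subrr add0r addrC.
  have := ND (N y *: (2^-1 *: (x' + y'))) ((N x - N y) *: (2^-1 *: x')).
  rewrite -e (NZ (N y)) (NZ (N x - N y)) (NZ 2^-1 x') nx' !ger0_norm ?subr_ge0 ?invr_ge0 // => h.
  have h1 : N y * N (2^-1 *: (x' + y')) <= N y * (1 - d).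
    by rewrite ler_wpM2l // hd.
  lra.
have mid2 : N (2^-1 *: (x + y)) <= (N x + N y) / 2 * (1 - d / 2).
  have h1 := ler_wpM2l (ltW d0) b3; have h2 := mulr_ge0 (ltW d0) b0.
  by apply: le_trans mid _; lra.
have : N (2^-1 *: (x + y)) ^+ 2 <= ((N x + N y) / 2 * (1 - d / 2)) ^+ 2.
  apply: lerXn2r => //; rewrite nnegrE.
  by apply: mulr_ge0; lra.
move=> /le_trans; apply; rewrite exprMn.
apply: (@le_trans _ _ ((N x ^+ 2 + N y ^+ 2) / 2 * (1 - d / 2))).
  apply: ler_pM; rewrite ?sqr_ge0 //; last by nra.
  by have := sqr_ge0 (N x - N y); lra.
have : c * (N x ^+ 2 + N y ^+ 2) <= d / 8 * (N x ^+ 2 + N y ^+ 2).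
  by rewrite ler_wpM2r // addr_ge0 ?sqr_ge0.
by lra.
Qed.

(** The constant is the same for all index sets [T]. *)
Lemma l2_midpoint_gap : exists2 eta : R, 0 < eta <= 1 &
  forall T : finType, midpoint_gap (l2_seminorm normN T) 32^-1 eta.
Proof.
(* With threshold [theta = 64^-2 = 32^-2 / 4], the terms in [theta] use up half
of the gain [c * 32^-2]. *)
have th : 0 < (64^-1 ^+ 2 : R) <= 1.
  rewrite exprn_gt0 ?invr_gt0 //= exprn_ile1 //; lra.
have [c /andP[c0 c1] hc] := midpoint_sqr th.
exists (c * (32^-1 ^+ 2 / 4)).
  have e0 : 0 < 32^-1 ^+ 2 / 4 :> R by rewrite divr_gt0 ?exprn_gt0 ?invr_gt0.
  have e1 : 32^-1 ^+ 2 / 4 <= 1 :> R by rewrite expr2; lra.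
  by rewrite mulr_gt0 //=; nra.
move=> T f g /= gf far.
have f0 := l2_ge0 N f; have [_ NZ _] := normN.
have h1 : l2 N (2^-1 *: (f + g)) ^+ 2 <= (l2 N f ^+ 2 + l2 N g ^+ 2) / 2 -
   c * (l2 N (f - g) ^+ 2 - 64^-1 ^+ 2 * (l2 N f ^+ 2 + l2 N g ^+ 2)).
  rewrite !l2_sqr -big_split /= mulr_suml [_ ^+ 2 * _]mulr_sumr -sumrB mulr_sumr -sumrB.
  apply: ler_sum => x _; have := hc (f x) (g x).
  by rewrite !ffunE.
have h2 : (32^-1 * l2 N f) ^+ 2 <= l2 N (f - g) ^+ 2.
  by apply: lerXn2r; rewrite ?nnegrE ?mulr_ge0 ?invr_ge0 ?l2_ge0.
rewrite -(@ler_pXn2r _ 2) ?nnegrE ?l2_ge0 //; last first.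
  by rewrite mulr_ge0 //; lra.
apply: le_trans h1 _; rewrite gf.
have h3 := ler_wpM2l (ltW c0) h2.
have h4 : 0 <= (c * (32^-1 ^+ 2 / 4) * l2 N f) ^+ 2 by exact: sqr_ge0.
by lra.
Qed.

End UniformConvexity.

(** * Elementary matrices and bounded generation *)

Section Elementary.
Local Open Scope ring_scope.
Variables (n : nat) (A : comPzRingType).
Implicit Types (i j k : 'I_n) (a b t : A).

Definition elem_mx i j t : 'M[A]_n := 1%:M + t *: delta_mx i j.

Lemma elem_mxE i j t k l :
  elem_mx i j t k l = (k == l)%:R + t * ((k == i) && (l == j))%:R.
Proof. by rewrite !mxE. Qed.

Lemma tr_elem_mx i j t : (elem_mx i j t)^T = elem_mx j i t.
Proof. by rewrite /elem_mx linearD /= tr_scalar_mx linearZ /= trmx_delta. Qed.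

(** An elementary matrix or its transpose is lower triangular with unit
diagonal. *)
Lemma det_elem_mx i j t : i != j -> \det (elem_mx i j t) = 1.
Proof.
wlog ij : i j / (j < i)%N => [hw nij|nij].
  have := nij; rewrite -val_eqE neq_ltn => /orP[lt_ij|]; last by move/hw; apply.
  by rewrite -det_tr tr_elem_mx; apply: hw; rewrite // eq_sym.
rewrite det_trig.
  rewrite big1 // => k _; rewrite elem_mxE eqxx.
  case: eqP => [->|_] /=; last by rewrite mulr0 addr0.
  by rewrite (negPf nij) mulr0 addr0.
apply/is_trig_mxP => k l kl; rewrite elem_mxE.
have -> : k == l = false by apply/eqP => e; rewrite e ltnn in kl.
case: eqP => [ki|]; case: eqP => [lj|] /=; rewrite ?mulr0 ?addr0 //.
by move: kl; rewrite ki lj; lia.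
Qed.

Lemma mul_elem_mxE i j t m (B : 'M[A]_(n, m)) k l :
  (elem_mx i j t *m B) k l = B k l + (k == i)%:R * (t * B j l).
Proof.
rewrite mulmxDl mul1mx !mxE; congr (_ + _).
rewrite (bigD1 j) //= big1 ?addr0 => [|j' /negPf j'j].
  by rewrite !mxE eqxx andbT mulrA [t * _]mulrC -mulrA; ring.
by rewrite !mxE j'j andbF mulr0 mul0r.
Qed.

Definition elem i j (nij : i != j) t : SL n A :=
  MkSL (introT eqP (det_elem_mx t nij)).

Lemma elemE i j (nij : i != j) t (g : SL n A) k l :
  SLval (elem nij t * g)%g k l = SLval g k l + (k == i)%:R * (t * SLval g j l).
Proof. exact: mul_elem_mxE. Qed.

Lemma SL_ext (g h : SL n A) : (forall k l, SLval g k l = SLval h k l) -> g = h.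
Proof. by move=> e; apply/val_inj/matrixP. Qed.

Lemma mul_elem_mx i j k l a b :
  elem_mx i j a *m elem_mx k l b =
    1%:M + a *: delta_mx i j + b *: delta_mx k l +
    (a * b) *: (delta_mx i l *+ (j == k)).
Proof.
rewrite mulmxDl mul1mx mulmxDr mulmx1 -scalemxAl -scalemxAr mul_delta_mx_cond.
by rewrite scalerA !addrA [1%:M + _ + _]addrAC.
Qed.

Lemma elemM i j (nij : i != j) a b :
  (elem nij a * elem nij b)%g = elem nij (a + b).
Proof.
apply: val_inj; rewrite /= mul_elem_mx eq_sym (negPf nij) mulr0n scaler0 addr0.
by rewrite /elem_mx scalerDl addrA.
Qed.

Lemma elem0 i j (nij : i != j) : elem nij 0 = 1%g.
Proof. by apply: val_inj; rewrite /= /elem_mx scale0r addr0. Qed.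

Lemma elemX i j (nij : i != j) p : (elem nij 1 ^+ p)%g = elem nij p%:R.
Proof.
elim: p => [|p IH]; first by rewrite elem0.
by rewrite monoid.expgS IH elemM -natr1 addrC.
Qed.

Lemma elem_commute i j k l (nij : i != j) (nkl : k != l) a b :
  j != k -> l != i -> commute (elem nij a) (elem nkl b).
Proof.
move=> njk nli; apply: val_inj; rewrite /= !mul_elem_mx (negPf njk) (negPf nli).
by rewrite !mulr0n !scaler0 !addr0 addrAC.
Qed.

Lemma elem_commutator i j k (nij : i != j) (njk : j != k) (nik : i != k) a b :
  (elem nij a * elem njk b)%g = (elem njk b * elem nij a * elem nik (a * b))%g.
Proof.
apply: val_inj; rewrite /= !mul_elem_mx eqxx mulr1n [k == i]eq_sym (negPf nik).
rewrite mulr0n scaler0 addr0 /elem_mx mulmxDr mulmx1 -scalemxAr.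
rewrite !mulmxDl mul1mx -!scalemxAl !mul_delta_mx_cond.
rewrite [k == i]eq_sym (negPf nik) [j == i]eq_sym (negPf nij).
by rewrite !mulr0n !scaler0 !addr0 [1%:M + _ + _]addrAC.
Qed.

End Elementary.

Section StableRange.
Local Open Scope ring_scope.
Variable m : nat.

Lemma Zmod_natr (x : Zmod m) : (x : nat)%:R = x.
Proof.
apply: val_inj; rewrite -[RHS](modn_small (ltn_ord x)) /=.
elim: (x : nat) => [|p IH]; first by rewrite mod0n.
rewrite mulrS; transitivity ((1 %% m.-1.+1 + (p%:R : Zmod m)) %% m.-1.+1)%N => //.
by rewrite IH modnDm add1n.
Qed.

Lemma Zmod_nat_coprime (x : Zmod m) :
  coprime m.-1.+1 (x : nat) -> exists w : Zmod m, w * x = 1.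
Proof. by move=> cx; exists (Zp_inv x); exact: Zp_mulVz cx. Qed.

(** Stable range 1: take for [t] the part of the modulus prime to [a].  A prime
factor of the modulus divides exactly one of [a] and [t], and it does not divide
[b] if it divides [a]; so it does not divide [a + t b]. *)
Lemma Zmod_stable_range (a b r : Zmod m) : r * a + b = 1 ->
  exists t w : Zmod m, w * (a + t * b) = 1.
Proof.
set p := m.-1.+1 => rab.
(* A predicate on primes rather than the set of primes of [a], so that [a = 0]
is no exception. *)
pose pi : nat_pred := [pred q | q %| (a : nat)]%N.
pose t := (p`_pi^')%N.
have main : coprime p (a + t * b)%N.
  apply/negPn/negP => ncop; set d := gcdn p (a + t * b) in ncop.
  have d0 : (0 < d)%N by rewrite gcdn_gt0.
  have d1 : (1 < d)%N by rewrite ltn_neqAle eq_sym ncop d0.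
  have pq := pdiv_prime d1; set q := pdiv d in pq.
  have qp : (q %| p)%N := dvdn_trans (pdiv_dvd d) (dvdn_gcdl _ _).
  have qx : (q %| a + t * b)%N := dvdn_trans (pdiv_dvd d) (dvdn_gcdr _ _).
  have qt : (q %| t)%N = ~~ (q %| (a : nat))%N.
    have [qa|qna] := boolP (q %| (a : nat))%N.
      apply/negP => qt; have := part_pnat pi^' p.
      by move/pnatP => /(_ (part_gt0 _ _) q pq qt); rewrite !inE qa.
    have : (q %| p`_pi * p`_pi^')%N by rewrite partnC.
    rewrite Euclid_dvdM // => /orP[qt|//].
    have := part_pnat pi p.
    by move/pnatP => /(_ (part_gt0 _ _) q pq qt); rewrite !inE (negPf qna).
  have [qa|qna] := boolP (q %| (a : nat))%N; last first.
    by move: qx; rewrite dvdn_addl ?(negPf qna) // dvdn_mulr // qt.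
  have qb : (q %| (b : nat))%N.
    by move: qx; rewrite dvdn_addr // Euclid_dvdM // qt qa.
  have := congr1 val rab.
  rewrite /= => e1; have : (q %| 1 %% p)%N.
    rewrite -[(1 %% p)%N]e1 /dvdn modn_dvdm // -/(dvdn _ _) dvdn_add //.
    by rewrite /dvdn modn_dvdm // -/(dvdn _ _) dvdn_mull.
  by rewrite /dvdn modn_dvdm // modn_small ?prime_gt1.
exists (inZp t); apply: Zmod_nat_coprime.
by rewrite /= modnMml modnDmr coprime_modr -/p.
Qed.

End StableRange.

Section BoundedGeneration.
Local Open Scope ring_scope.
Variables (n m : nat) (R : numDomainType) (M : SL n (Zmod m) -> R) (mu : R).
Hypothesis mu0 : 0 <= mu.
Hypothesis hM : forall (i j : 'I_n) (nij : i != j) t g,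
  M g <= mu + M (elem nij t * g)%g.
Implicit Types (g : SL n (Zmod m)) (k : 'I_n) (s : seq 'I_n) (t : 'I_n -> Zmod m).

Lemma add_rows k s t g : k \notin s -> exists2 g' : SL n (Zmod m),
  M g <= (size s)%:R * mu + M g' &
  forall a b, SLval g' a b =
    SLval g a b + (a == k)%:R * \sum_(i <- s) t i * SLval g i b.
Proof.
elim: s => [|i s IH] /= ks.
  by exists g; rewrite ?mul0r ?add0r // => a b; rewrite big_nil mulr0 addr0.
move: ks; rewrite inE negb_or => /andP[ki /IH[g' hg' eg']].
exists (elem ki (t i) * g')%g.
  rewrite -natr1 mulrDl mul1r -addrA; apply: le_trans hg' _.
  by rewrite lerD2l hM.
move=> a b; rewrite elemE !eg' big_cons [i == k]eq_sym (negPf ki) mul0r addr0.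
by rewrite mulrDr [in RHS]addrA addrAC.
Qed.

Lemma clear_column k s t g : uniq s -> k \notin s -> exists2 g' : SL n (Zmod m),
  M g <= (size s)%:R * mu + M g' &
  forall a b, SLval g' a b =
    SLval g a b + (a \in s)%:R * (t a * SLval g k b).
Proof.
elim: s => [|i s IH] /=.
  by exists g; rewrite ?mul0r ?add0r // => a b; rewrite mul0r addr0.
case/andP=> nis us; rewrite inE negb_or => /andP[ki ks].
have [g' hg' eg'] := IH us ks; have ik : i != k by rewrite eq_sym.
exists (elem ik (t i) * g')%g.
  rewrite -natr1 mulrDl mul1r -addrA; apply: le_trans hg' _.
  by rewrite lerD2l hM.
move=> a b; rewrite elemE !eg' (negPf ks) mul0r addr0 inE.
case: eqP => [->|_] /=; last by rewrite mul0r addr0.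
by rewrite (negPf nis) mul0r addr0.
Qed.

(** Gaussian elimination proceeds column by column; [fixes p g] says that the
first [p] columns are those of the identity. *)
Definition fixes (p : nat) g := forall (j : 'I_n), (j < p)%N ->
  forall i : 'I_n, SLval g i j = (i == j)%:R.

Lemma fixes_clear k g : fixes k g -> SLval g k k = 1 ->
  exists2 g', M g <= n%:R * mu + M g' & fixes k.+1 g'.
Proof.
move=> fg gkk; pose s := rem k (enum 'I_n).
have us : uniq s by rewrite rem_uniq ?enum_uniq.
have ks : k \notin s by rewrite mem_rem_uniqF ?enum_uniq.
have [g' hg' eg'] := clear_column (fun a => - SLval g a k) g us ks.
exists g'.
  apply: le_trans hg' _; rewrite lerD2r ler_wpM2r // ler_nat size_rem ?mem_enum //.
  by rewrite size_enum_ord leq_pred.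
move=> j; rewrite ltnS leq_eqVlt => /orP[/eqP/val_inj ->|jk] i; rewrite eg'.
  rewrite gkk mulr1 mem_rem_uniq ?enum_uniq // inE mem_enum andbT.
  case: eqP => [->|_] /=; first by rewrite mul0r addr0.
  by rewrite mul1r subrr.
rewrite !(fg j jk); have -> : k == j = false by apply/eqP => e; rewrite e ltnn in jk.
by rewrite !mulr0 addr0.
Qed.

Lemma fixes_inv p g : fixes p g -> fixes p g^-1%g.
Proof.
move=> fg; have := monoid.mulVg g; move: (g^-1)%g => h hg j jp i.
have := congr1 (fun x => SLval x i j) hg.
rewrite /= !mxE (bigD1 j) //= big1 => [|l /negPf lj].
  by rewrite addr0 fg // eqxx mulr1.
by rewrite fg // lj mulr0.
Qed.

(** The inverse of [g] also has its first [k] columns trivial, so its [k]-th row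
shows that the entries of column [k] in the rows from [k] on generate the unit
ideal.  Stable range 1 makes the pivot a unit [u] by one round of row additions;
using [u], the entry below the pivot is turned into 1, and with that entry the
pivot itself. *)
Lemma fixes_pivot k g : fixes k g -> (k.+1 < n)%N ->
  exists2 g', M g <= (n + 2)%:R * mu + M g' & fixes k g' /\ SLval g' k k = 1.
Proof.
move=> fg kn; pose l : 'I_n := Ordinal kn.
have kl : k != l by rewrite -val_eqE /= ltn_eqF.
have lk : l != k by rewrite eq_sym.
have := fixes_inv fg; have := monoid.mulVg g; move: (g^-1)%g => g' g'g fg'.
pose h (i : 'I_n) : Zmod m := SLval g' k i.
have uni : h k * SLval g k k + \sum_(i : 'I_n | (k < i)%N) h i * SLval g i k = 1.
  have := congr1 (fun x => SLval x k k) g'g.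
  rewrite /= !mxE eqxx (bigD1 k) //= => hk.
  rewrite -[RHS]/(true%:R) -[RHS]hk; congr (_ + _).
  rewrite [RHS](bigID (fun i : 'I_n => (k < i)%N)) /=.
  rewrite [X in _ = _ + X]big1 ?addr0 => [|i /andP[ik ki]].
    apply: eq_bigl => i; apply/idP/andP => [ki|[]//]; split=> //.
    by apply/eqP => e; rewrite e ltnn in ki.
  have lt_ik : (i < k)%N by rewrite ltn_neqAle val_eqE ik leqNgt.
  by rewrite fg' // eq_sym (negPf ik) mul0r.
have [c [w hw]] := Zmod_stable_range uni.
pose s := [seq i : 'I_n <- enum 'I_n | (k < i)%N].
have ks : k \notin s by rewrite mem_filter ltnn.
have [g1 hg1 eg1] := add_rows (fun i => c * h i) g ks.
set u := SLval g k k + c * _ in hw.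
have g1k : SLval g1 k k = u.
  rewrite eg1 eqxx mul1r /u; congr (_ + _); rewrite big_filter big_enum_cond /=.
  by rewrite mulr_sumr; apply: eq_bigr => i _; rewrite mulrA.
have f1 : fixes k g1.
  move=> j jk i; rewrite eg1 (fg j jk) big1_seq ?mulr0 ?addr0 // => i' /andP[_].
  rewrite mem_filter => /andP[ki' _]; rewrite (fg j jk).
  have -> : i' == j = false by apply/eqP => e; rewrite e in ki'; lia.
  by rewrite mulr0.
pose g2 := (elem lk (w * (1 - SLval g1 l k)) * g1)%g.
have f2 : fixes k g2.
  move=> j jk i; rewrite elemE !(f1 j jk).
  have -> : k == j = false by apply/eqP => e; rewrite e ltnn in jk.
  by rewrite !mulr0 addr0.
have g2l : SLval g2 l k = 1.
  by rewrite elemE eqxx mul1r g1k mulrAC hw mul1r addrC subrK.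
have g2k : SLval g2 k k = u by rewrite elemE (negPf kl) mul0r addr0.
exists (elem kl (1 - u) * g2)%g.
  apply: le_trans hg1 _; apply: le_trans (lerD (lexx _) (hM lk (w * (1 - SLval g1 l k)) _)) _.
  apply: le_trans (lerD (lexx _) (lerD (lexx _) (hM kl (1 - u) _))) _.
  rewrite -/g2 !addrA lerD2r natrD mulrDl -[leLHS]addrA; apply: lerD.
    rewrite ler_wpM2r // ler_nat size_filter.
    by apply: leq_trans (count_size _ _) _; rewrite size_enum_ord.
  by rewrite mulr_natl mulr2n.
split; last by rewrite elemE eqxx mul1r g2k g2l mulr1 addrC subrK.
move=> j jk i; rewrite elemE !(f2 j jk).
have -> : l == j = false by apply/eqP => e; rewrite -e /= in jk; lia.
by rewrite !mulr0 addr0.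
Qed.

(** For the last column no row is left below the pivot; the determinant forces
the pivot to be 1. *)
Lemma fixes_last k g : fixes k g -> n = k.+1 -> SLval g k k = 1.
Proof.
move=> fg nk; rewrite -(eqP (SL_det g)) -det_tr det_trig; last first.
  apply/is_trig_mxP => i j ij; rewrite mxE fg; last by have := ltn_ord j; lia.
  by have -> : j == i = false by apply/eqP => e; rewrite e ltnn in ij.
rewrite (bigD1 k) //= mxE big1 ?mulr1 // => i ik; rewrite mxE fg ?eqxx //.
by have := ltn_ord i; move: ik; rewrite -val_eqE /=; lia.
Qed.

Lemma fixes_step k g : fixes k g ->
  exists2 g', M g <= (2 * n + 2)%:R * mu + M g' & fixes k.+1 g'.
Proof.
move=> fg; have [kn|nk] := ltnP k.+1 n.
  have [g1 h1 [f1 p1]] := fixes_pivot fg kn.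
  have [g2 h2 f2] := fixes_clear f1 p1; exists g2 => //.
  apply: le_trans h1 _; apply: le_trans (lerD (lexx _) h2) _.
  by rewrite addrA -mulrDl -natrD; have -> : (n + 2 + n = 2 * n + 2)%N by lia.
have nk' : n = k.+1 by have := ltn_ord k; lia.
have [g2 h2 f2] := fixes_clear fg (fixes_last fg nk'); exists g2 => //.
apply: le_trans h2 _; rewrite lerD2r ler_wpM2r // ler_nat; lia.
Qed.

(** Stated for a function [M] which grows by at most [mu] under multiplication
by an elementary matrix: this is how bounded generation is used, and it avoids
words in the generators. *)
Lemma bounded_generation g : M g <= (n * (2 * n + 2))%:R * mu + M 1%g.
Proof.
suff H p : (p <= n)%N -> exists2 g', M g <= (p * (2 * n + 2))%:R * mu + M g' & fixes p g'.
  have [g' hg' fg'] := H n (leqnn n).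
  suff <- : g' = 1%g by [].
  by apply: SL_ext => i j; rewrite fg' // mxE.
elim: p => [|p IH] pn; first by exists g => //; rewrite mul0n mul0r add0r.
have [g1 h1 f1] := IH (ltnW pn).
have [g2 h2 f2] := fixes_step (k := Ordinal pn) f1; exists g2 => //.
apply: le_trans h1 _; apply: le_trans (lerD (lexx _) h2) _.
by rewrite addrA -mulrDl -natrD mulSn addnC.
Qed.

End BoundedGeneration.

(** * Right translations on the special linear groups *)

Section Translations.
Local Open Scope ring_scope.
Variables (R : realType) (E : completeNormedModType R) (N : E -> R).
Hypothesis normN : is_norm N.
Variable G : finGroupType.
Local Notation L := (l2_seminorm normN G).
Implicit Types (f : {ffun G -> E}) (g h k : G).

Definition translate g f : {ffun G -> E} := [ffun x => f (x * g)%g].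

Lemma translate_lin g (a : R) f f' :
  translate g (a *: f + f') = a *: translate g f + translate g f'.
Proof. by apply/ffunP => x; rewrite !ffunE. Qed.

Lemma translate_norm g f : L (translate g f) = L f.
Proof.
rewrite /= /l2; congr Num.sqrt.
rewrite [RHS](reindex_inj (mulIg g)) /=.
by apply: eq_bigr => x _; rewrite ffunE.
Qed.

(** Right translation makes the square of [displacement f s] a sum over the
edges between [x] and [x * s]. *)
Definition translation g : contraction L :=
  Contraction (translate_lin g) (fun f => eq_ind_r (fun r => r <= L f) (lexx _) (translate_norm g f)).

Lemma translationE g f x : translation g f x = f (x * g)%g.
Proof. by rewrite ffunE. Qed.

Lemma translation1 f : translation 1%g f = f.
Proof. by apply/ffunP => x; rewrite translationE mulg1. Qed.

Lemma translationM g h f : translation (g * h)%g f = translation g (translation h f).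
Proof. by apply/ffunP => x; rewrite !translationE mulgA. Qed.

Definition cyclic_flow g : flow L.
Proof.
apply: (@Flow _ _ _ (fun a => translation (g ^+ a)%g)).
- by move=> f; rewrite expg0 translation1.
- by move=> a b f; rewrite expgD translationM.
- by move=> a f; exact: translate_norm.
Defined.

Lemma cyclic_flowE g a f : cyclic_flow g a f = translation (g ^+ a)%g f.
Proof. by []. Qed.

Lemma heisenberg_group g h k : commute g k -> commute h k ->
  (forall a b, g ^+ a * h ^+ b = h ^+ b * g ^+ a * k ^+ (a * b))%g ->
  heisenberg (cyclic_flow g) (cyclic_flow h) (cyclic_flow k).
Proof.
move=> gk hk ghk; split.
- by move=> a b f; rewrite !cyclic_flowE -!translationM (commuteX2 _ _ gk).
- by move=> a b f; rewrite !cyclic_flowE -!translationM (commuteX2 _ _ hk).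
move=> a b f; rewrite !cyclic_flowE -!translationM ghk [X in X - _]translationM -contrB.
exact: translate_norm.
Qed.

Definition displacement f g := L (translation g f - f).

Lemma displacementM f g h : displacement f (g * h)%g <= displacement f g + displacement f h.
Proof.
rewrite /displacement translationM.
apply: le_trans (snorm_dist_triangle L (translation g f) _ _) _.
by rewrite -contrB addrC lerD2l translate_norm.
Qed.

Lemma displacementV f g : displacement f g^-1%g = displacement f g.
Proof.
rewrite /displacement -(translate_norm g) -[translate g]/(contraction_fun (translation g)).
by rewrite contrB -translationM mulgV translation1 snorm_distC.
Qed.

Lemma displacement1 f : displacement f 1%g = 0.
Proof. by rewrite /displacement translation1 subrr snorm0. Qed.

Lemma displacement_sqr f g :
  displacement f g ^+ 2 = \sum_x N (f (x * g)%g - f x) ^+ 2.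
Proof. by rewrite l2_sqr; apply: eq_bigr => x _; rewrite !ffunE. Qed.

(** The average of all translates of [f] is the constant function equal to the
mean of [f], which is 0; so [f] is the average of the differences between [f]
and its translates. *)
Lemma mean_zero_le f (c : R) : \sum_x f x = 0 ->
  (forall g, displacement f g <= c) -> L f <= c.
Proof.
move=> f0 hc; have G0 : 0 < #|G|%:R :> R by rewrite ltr0n; apply/card_gt0P; exists 1%g.
have e : #|G|%:R *: f = \sum_g (f - translation g f).
  rewrite sumrB sumr_const scaler_nat.
  have -> : \sum_g translation g f = 0; last by rewrite subr0.
  apply/ffunP => x; rewrite sum_ffunE ffunE -[RHS]f0.
  rewrite [RHS](reindex_inj (mulgI x)) /=.
  by apply: eq_bigr => g _; rewrite ffunE.
have sum_le (I : Type) (r : seq I) (F : I -> {ffun G -> E}) :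
    L (\sum_(i <- r) F i) <= \sum_(i <- r) L (F i).
  elim: r => [|i r IH]; first by rewrite !big_nil snorm0.
  by rewrite !big_cons; apply: le_trans (snormD L _ _) _; rewrite lerD2l.
rewrite -(ler_pM2l G0) -{1}[#|G|%:R]ger0_norm ?(ltW G0) // -snormZ e.
apply: le_trans (sum_le _ _ _) _.
rewrite mulr_natl -sumr_const; apply: ler_sum => g _.
by rewrite snorm_distC; exact: hc.
Qed.

End Translations.

Section SLHexagon.
Local Open Scope ring_scope.
Variables (R : realType) (E : completeNormedModType R) (N : E -> R).
Hypothesis normN : is_norm N.
Variables (n m : nat).
Local Notation G := (SL n (Zmod m)).
Local Notation L := (l2_seminorm normN G).
Local Notation root nij := (cyclic_flow normN (elem nij 1 : G)).

Lemma heisenberg_elem (i j k : 'I_n) (nij : i != j) (njk : j != k) (nik : i != k) :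
  heisenberg (root nij) (root njk) (root nik).
Proof.
apply: heisenberg_group.
- by apply: elem_commute; rewrite eq_sym.
- by apply: elem_commute; rewrite eq_sym.
by move=> a b; rewrite !elemX natrM; exact: elem_commutator.
Qed.

(** The roots of [A_2] in cyclic order, realized in the entries indexed by [i],
[j] and [k]. *)
Definition hexagon_flows (i j k : 'I_n)
    (nij : i != j) (nik : i != k) (njk : j != k)
    (nji : j != i) (nki : k != i) (nkj : k != j) (p : nat) : flow L :=
  match p with
  | 0 => root nij | 1 => root nik | 2 => root njk
  | 3 => root nji | 4 => root nki | _ => root nkj
  end.

Lemma hexagon_SL (i j k : 'I_n) (nij : i != j) (nik : i != k) (njk : j != k)
    (nji : j != i) (nki : k != i) (nkj : k != j) :
  hexagon (hexagon_flows nij nik njk nji nki nkj).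
Proof.
case=> [|[|[|[|[|[|p]]]]]] hp; last by [].
- exact: heisenberg_elem.
- exact/heisenberg_sym/heisenberg_elem.
- exact: heisenberg_elem.
- exact/heisenberg_sym/heisenberg_elem.
- exact: heisenberg_elem.
- exact/heisenberg_sym/heisenberg_elem.
Qed.

Lemma red_elem (i j : 'I_n) (nij : i != j) :
  SL_red m (elem nij (1 : int)) = elem nij 1.
Proof.
apply: SL_ext => k l; rewrite elem_mxE !mxE !mul1r mulrzDr.
by rewrite !mulrz_nat.
Qed.

Lemma displacement_word (S : seq (SL n int)) (D : R) (f : {ffun G -> E})
    (w : seq (SL n int)) :
  0 <= D ->
  {in S, forall s, displacement normN f (SL_red m s) <= D} ->
  all (fun g => (g \in S) || (g^-1%g \in S)) w ->
  displacement normN f (SL_red m (\prod_(g <- w) g)%g) <= (size w)%:R * D.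
Proof.
move=> D0 hS; elim: w => [|g w IH] /=.
  by rewrite big_nil SL_red1 displacement1 mul0r.
case/andP=> hg /IH hw; rewrite big_cons SL_redM.
apply: le_trans (displacementM _ _ _ _) _.
rewrite -natr1 mulrDl mul1r addrC lerD //.
case/orP: hg => [|gS]; first exact: hS.
rewrite -displacementV; have -> : (SL_red m g)^-1%g = SL_red m g^-1%g; last exact: hS.
by apply: (mulgI (SL_red m g)); rewrite mulgV -SL_redM monoid.mulgV SL_red1.
Qed.

End SLHexagon.

Lemma third_index n (i j : 'I_n) : (3 <= n)%N -> exists k : 'I_n, (k != i) && (k != j).
Proof.
move=> n3; have : (0 < #|~: [set i; j]|)%N.
  rewrite cardsCs finset.setCK card_ord subn_gt0; apply: leq_ltn_trans n3.
  by rewrite cards2; case: (i != j).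
by case/card_gt0P => k; rewrite !inE negb_or => hk; exists k.
Qed.

(** * Uniform displacement and the Poincare inequality *)

Section Poincare.
Local Open Scope ring_scope.
Variables (R : realType) (E : completeNormedModType R) (N : E -> R).
Hypotheses (normN : is_norm N) (ucN : uniformly_convex N).
Variables (n : nat) (S : seq (SL n int)).
Hypotheses (n3 : (3 <= n)%N) (genS : generates S).

(** The word in the generators that expresses an elementary matrix is taken over
the integers, so its length does not depend on the modulus. *)
Lemma elem_length : exists l : nat, forall (m : nat) (f : {ffun SL n (Zmod m) -> E}) (D : R),
  0 <= D -> {in S, forall s, displacement normN f (SL_red m s) <= D} ->
  forall (i j : 'I_n) (nij : i != j), displacement normN f (elem nij 1) <= l%:R * D.
Proof.
have /choice[len hlen] : forall x : SL n int, exists l : nat, exists w : seq (SL n int),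
    [/\ size w = l, all (fun g => (g \in S) || (g^-1%g \in S)) w & x = (\prod_(g <- w) g)%g].
  by move=> x; have [w hw ->] := genS x; exists (size w), w.
pose F (i j : 'I_n) : nat := if boolP (i != j) is AltTrue nij then len (elem nij 1) else 0%N.
exists (\sum_i \sum_j F i j)%N => m f D D0 hD i j nij.
rewrite -red_elem; have [w [sw hw ->]] := hlen (elem nij 1).
apply: le_trans (displacement_word D0 hD hw) _.
rewrite ler_wpM2r // ler_nat sw (bigD1 i) //= (bigD1 j) //= -addnA.
rewrite {1}/F; case: {-}_ / (boolP (i != j)) => [nij'|]; last by rewrite nij.
by rewrite (bool_irrelevance nij nij') leq_addr.
Qed.

(** Let [B] bound the elementary length of the elements of the group and apply
[relative_invariance] with [eps = 1 / (2 B)].  Then [mu = K l D + eps * N f]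
bounds the displacement by elementary matrices, [B mu] that by all elements,
hence also [N f] because [f] has mean zero; so [eps * N f <= mu / 2] and [mu <=
2 K l D]. *)
Theorem uniform_displacement : exists2 K : R, 0 <= K &
  forall (m : nat) (f : {ffun SL n (Zmod m) -> E}) (D : R), \sum_x f x = 0 ->
  0 <= D -> {in S, forall s, displacement normN f (SL_red m s) <= D} ->
  forall g, displacement normN f g <= K * D.
Proof.
have [eta eta01 gap] := l2_midpoint_gap normN ucN.
have [l hl] := elem_length.
pose B : R := (n * (2 * n + 2))%:R.
have B1 : 1 <= B by rewrite ler1n muln_gt0; lia.
have eps0 : 0 < (2 * B)^-1 by rewrite invr_gt0; lra.
have [K K0 hK] := relative_invariance eta01 eps0.
exists (B * (2 * (K * l%:R))); first by rewrite !mulr_ge0 //; lra.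
move=> m f D f0 D0 hD.
have el := hl m f D D0 hD.
pose mu := K * (l%:R * D) + (2 * B)^-1 * l2_seminorm normN _ f.
have hmu (i j : 'I_n) (nij : i != j) t : displacement normN f (elem nij t) <= mu.
  have [k /andP[nki nkj]] := third_index i j n3.
  have nik : i != k by rewrite eq_sym.
  have njk : j != k by rewrite eq_sym.
  have nji : j != i by rewrite eq_sym.
  have := hK _ _ _ (gap _) (hexagon_SL normN m nij nik njk nji nki nkj) f (l%:R * D).
  move=> /(_ _ (t : nat)); rewrite /mu => h.
  rewrite -[t]Zmod_natr -elemX; apply: h.
  by case=> [|[|[|[|[|[|p]]]]]] hp; rewrite ?cyclic_flowE ?expg1; [exact: el ..|].
have mu0 : 0 <= mu by rewrite addr_ge0 ?mulr_ge0 ?snorm_ge0 // ltW.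
have bound g : displacement normN f g <= B * mu.
  have := @bounded_generation n m R (displacement normN f) mu mu0.
  move=> /(_ _ g); rewrite displacement1 addr0; apply.
  move=> i j nij t h; have e : h = ((elem nij t)^-1 * (elem nij t * h))%g by rewrite mulKg.
  rewrite {1}e; apply: le_trans (displacementM _ _ _ _) _.
  by rewrite displacementV lerD2r.
have fB := mean_zero_le f0 bound.
have hmu2 : mu <= 2 * (K * (l%:R * D)).
  have : (2 * B)^-1 * l2_seminorm normN _ f <= (2 * B)^-1 * (B * mu).
    by rewrite ler_wpM2l // ltW.
  have -> : (2 * B)^-1 * (B * mu) = mu / 2 by rewrite invfM -mulrA mulKf 1?mulrC // gt_eqF //; lra.
  have e : mu = K * (l%:R * D) + (2 * B)^-1 * l2_seminorm normN _ f by [].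
  by move: e; clearbody mu => e h; lra.
move=> g; apply: le_trans (bound g) _; rewrite -!mulrA ler_wpM2l ?(le_trans ler01) //.
Qed.

End Poincare.

Section Graphs.
Local Open Scope ring_scope.

Lemma cayley_degree (G : finGroupType) (S : seq G) (x : G) :
  (#|[pred y | cayley_rel S x y]| <= 2 * size S)%N.
Proof.
pose r := map (fun s => x * s)%g S ++ map (fun s => x * s^-1)%g S.
apply: (@leq_trans #|r|).
  apply/subset_leq_card/fintype.subsetP => y; rewrite !inE mem_cat => /orP[h|h]; apply/orP.
    by left; apply/mapP; exists (x^-1 * y)%g; rewrite // mulKVg.
  by right; apply/mapP; exists (y^-1 * x)%g; rewrite // invMg invgK mulKVg.
apply: leq_trans (card_size _) _.
by rewrite size_cat !size_map addnn mul2n.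
Qed.

Lemma card_SL_ge (n m : nat) : (1 < n)%N -> (m < #|{: SL n (Zmod m.+1)}|)%N.
Proof.
case: n => [|[|n]] // _.
have n01 : (ord0 : 'I_n.+2) != lift ord0 ord0 by [].
have inj : injective (fun t : Zmod m.+1 => elem n01 t).
  move=> s t /(congr1 (fun x => SLval x ord0 (lift ord0 ord0))).
  by rewrite !elem_mxE !eqxx /= !mulr1 !add0r.
by have := leq_card _ inj; rewrite card_ord.
Qed.

Lemma edge_sum_displacement (R : realType) (E : completeNormedModType R)
    (N : E -> R) (normN : is_norm N) (G : finGroupType) (S : seq G)
    (f : {ffun G -> E}) (s : G) : s \in S ->
  displacement normN f s <= Num.sqrt
    (\sum_(xy : G * G | cayley_rel S xy.1 xy.2) N (f xy.1 - f xy.2) ^+ 2).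
Proof.
move=> sS; have [_ NZ _] := normN.
rewrite -[leLHS]ger0_norm ?snorm_ge0 // -sqrtr_sqr ler_sqrt; last first.
  by apply: sumr_ge0 => xy _; exact: sqr_ge0.
rewrite displacement_sqr.
rewrite -(pair_big_dep predT (cayley_rel S) (fun x y => N (f x - f y) ^+ 2)) /=.
apply: ler_sum => x _; rewrite (bigD1 (x * s)%g) /=; last first.
  by rewrite /cayley_rel mulKg sS.
rewrite -opprB -scaleN1r NZ normrN1 mul1r lerDl.
by apply: sumr_ge0 => y _; exact: sqr_ge0.
Qed.

(** Group the pairs [(u, v)] by [u^-1 v]. *)
Lemma pair_sum_displacement (R : realType) (E : completeNormedModType R)
    (N : E -> R) (normN : is_norm N) (G : finGroupType) (f : {ffun G -> E}) :
  \sum_(uv : G * G) N (f uv.1 - f uv.2) ^+ 2 =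
    \sum_g displacement normN f g ^+ 2.
Proof.
have [_ NZ _] := normN.
rewrite -(pair_bigA _ (fun x y => N (f x - f y) ^+ 2)) /=.
under [RHS]eq_bigr do rewrite displacement_sqr.
rewrite [RHS]exchange_big /=; apply: eq_bigr => x _.
rewrite (reindex_inj (mulgI x)) /=; apply: eq_bigr => y _.
by rewrite -opprB -scaleN1r NZ normrN1 mul1r.
Qed.

Lemma displacement_sub_const (R : realType) (E : completeNormedModType R)
    (N : E -> R) (normN : is_norm N) (G : finGroupType) (f : {ffun G -> E})
    (e : E) (g : G) :
  displacement normN [ffun x => f x - e] g = displacement normN f g.
Proof.
rewrite /displacement; congr (l2_seminorm normN G _).
by apply/ffunP => x; rewrite !ffunE opprB addrA subrK.
Qed.

Lemma cayley_poincare (R : realType) (E : completeNormedModType R)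
    (N : E -> R) (n : nat) (S : seq (SL n int)) :
  is_norm N -> uniformly_convex N -> (3 <= n)%N -> generates S ->
  exists2 K : R, 0 <= K & forall (m : nat) (f : SL n (Zmod m) -> E),
  \sum_(uv : SL n (Zmod m) * SL n (Zmod m)) N (f uv.1 - f uv.2) ^+ 2 <=
    K * #|{: SL n (Zmod m)}|%:R *
    \sum_(xy : SL n (Zmod m) * SL n (Zmod m) |
        cayley_rel (map (SL_red m) S) xy.1 xy.2) N (f xy.1 - f xy.2) ^+ 2.
Proof.
move=> normN ucN n3 genS.
have [K K0 hK] := uniform_displacement normN ucN n3 genS.
exists (K ^+ 2); first exact: sqr_ge0.
move=> m f0; set G := SL n (Zmod m).
pose f : {ffun G -> E} := [ffun x => f0 x].
pose e := #|{: G}|%:R^-1 *: \sum_x f x.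
pose f' : {ffun G -> E} := [ffun x => f x - e].
set D2 := (X in _ <= _ * X).
have D20 : 0 <= D2 by apply: sumr_ge0 => xy _; exact: sqr_ge0.
have G0 : #|{: G}|%:R != 0 :> R.
  by rewrite pnatr_eq0 -lt0n; apply/card_gt0P; exists 1%g.
have mean : \sum_x f' x = 0.
  under eq_bigr do rewrite ffunE.
  by rewrite sumrB sumr_const -scaler_nat scalerA divff // scale1r subrr.
have hS : {in S, forall s, displacement normN f' (SL_red m s) <= Num.sqrt D2}.
  move=> s sS; rewrite displacement_sub_const.
  apply: le_trans (edge_sum_displacement (S := map (SL_red m) S) normN _ _) _.
    exact: map_f.
  rewrite le_eqVlt; apply/orP; left; apply/eqP; congr Num.sqrt.
  by apply: eq_bigr => xy _; rewrite !ffunE.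
have := hK m f' _ mean (sqrtr_ge0 _) hS => {}hK.
have -> : \sum_(uv : G * G) N (f0 uv.1 - f0 uv.2) ^+ 2 =
    \sum_g displacement normN f' g ^+ 2.
  rewrite (eq_bigr (fun uv : G * G => N (f uv.1 - f uv.2) ^+ 2)); last first.
    by move=> uv _; rewrite !ffunE.
  rewrite (pair_sum_displacement normN); apply: eq_bigr => g _.
  by rewrite displacement_sub_const.
rewrite mulrAC mulr_natr -sumr_const; apply: ler_sum => g _.
rewrite -[D2]sqr_sqrtr // -exprMn; apply: lerXn2r; rewrite ?nnegrE //.
  exact: snorm_ge0.
by rewrite mulr_ge0 ?sqrtr_ge0.
Qed.

End Graphs.

Theorem theorem1p6 (R : realType) (n : nat) (S : seq (SL n int)) :
  (3 <= n)%N -> generates S ->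
  super_expander_family R
    (fun i : nat =>
       cayley_graph (map (fun s : SL n int => SL_red i.+1 s) S)).
Proof.
move=> n3 genS; split.
- exists (2 * size S)%N => i x.
  have := cayley_degree (map (SL_red i.+1) S) x; rewrite size_map.
  exact: leq_trans.
- apply/cvgnyPge => A; exists A => // i /= Ai.
  apply: leq_trans (ltnW (card_SL_ge i _)); first exact: Ai.
  by apply: leq_trans n3.
move=> E [N [normN [c [C [c0 C0 eqN]]] ucN]].
have [K K0 hK] := cayley_poincare normN ucN n3 genS.
exists 2%R, (c ^- 2 * K * C ^+ 2 + 1)%R; split => //.
  apply: ltr_wpDl; last exact: ltr01.
  by rewrite !mulr_ge0 ?invr_ge0 ?exprn_ge0 ?(ltW c0) ?(ltW C0).
move=> i phi.
have sq (x : E) : (`|x| `^ 2 = `|x| ^+ 2)%R by rewrite powR_mulrn.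
rewrite (eq_bigr (fun uv => `|phi uv.1 - phi uv.2| ^+ 2)%R) => [|uv _]; last exact: sq.
rewrite [X in (_ <= _ * X)%R](eq_bigr (fun uv => `|phi uv.1 - phi uv.2| ^+ 2)%R)
  => [|uv _]; last exact: sq.
set A := (X in (_ * X <= _)%R); set B := (X in (_ <= _ * X)%R).
set q : R := (_%:R)%R.
have q0 : (0 < q)%R by rewrite ltr0n; apply/card_gt0P; exists 1%g.
have hAB := hK i.+1 phi; rewrite -/q in hAB.
set A' := (X in (X <= _)%R) in hAB; set B' := (X in (_ <= _ * X)%R) in hAB.
have Nge0 x : (0 <= N x)%R by exact: (snorm_ge0 (norm_seminorm normN)).
have hA : (A <= c ^- 2 * A')%R.
  rewrite /A /A' mulr_sumr; apply: ler_sum => uv _.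
  rewrite mulrC ler_pdivlMr ?exprn_gt0 // mulrC -exprMn.
  have /andP[h _] := eqN (phi uv.1 - phi uv.2)%R.
  by apply: lerXn2r; rewrite ?nnegrE ?Nge0 ?mulr_ge0 ?(ltW c0).
have hB : (B' <= C ^+ 2 * B)%R.
  rewrite /B /B' mulr_sumr; apply: ler_sum => uv _; rewrite -exprMn.
  have /andP[_ h] := eqN (phi uv.1 - phi uv.2)%R.
  by apply: lerXn2r; rewrite ?nnegrE ?Nge0 ?mulr_ge0 ?(ltW C0).
have B0 : (0 <= B)%R by apply: sumr_ge0 => xy _; exact: sqr_ge0.
have key : (A <= (c ^- 2 * K * C ^+ 2) * q * B)%R.
  apply: le_trans hA _; rewrite -!mulrA; apply: ler_wpM2l.
    by rewrite invr_ge0 exprn_ge0 ?(ltW c0).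
  apply: le_trans hAB _; rewrite -mulrA; apply: ler_wpM2l => //.
  have -> : (C * (C * (q * B)) = q * (C ^+ 2 * B))%R by ring.
  by apply: ler_wpM2l => //; exact: ltW.
rewrite mulrC ler_pdivrMr ?exprn_gt0 //; apply: le_trans key _.
have -> : ((c ^- 2 * K * C ^+ 2 + 1) / q * B * q ^+ 2 =
   (c ^- 2 * K * C ^+ 2) * q * B + q * B)%R.
  move: (c ^- 2 * K * C ^+ 2)%R => x; rewrite expr2; field; exact: lt0r_neq0.
by rewrite lerDl mulr_ge0 // ltW.
Qed.
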